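(* Let $\Omega\subset\mathbb{R}^d$ be a compact, full-dimensional, semianalytic set, let $f:\Omega\to\mathbb{R}$ be real analytic such that $\{f=0\}$ is a smooth hypersurface meeting the interior of $\Omega$, and let $\varphi:\Omega\to\mathbb{R}$ be real analytic and positive. Suppose $\partial f/\partial\omega_1$ is nonvanishing in $\Omega$. Let $W$ be the projection of the hypersurface $\{f=0\}\subset\Omega$ onto the subspace $\{(\omega_2,\dots,\omega_d)\in\mathbb{R}^{d-1}\}$, and let $\rho:\Omega\to\mathbb{R}^d$ be the map $\omega\mapsto(f(\omega),\omega_2,\dots,\omega_d)$. If the boundary of $\Omega$ intersects transversally with the hypersurface $\{f=0\}$, then $$V(\lambda):=\int_{\{\omega\in\Omega:|f(\omega)|\le\lambda\}}\varphi(\omega)\,d\omega\;\approx\;C\lambda$$ asymptotically as $\lambda\to0$, where $$C=2\int_W\Bigl(\frac{\varphi}{|\partial f/\partial\omega_1|}\circ\rho^{-1}\Bigr)(0,\omega_2,\dots,\omega_d)\,d\omega_2\cdots d\omega_d.$$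
   Context: All measures are standard Lebesgue measures. The hypersurface $\{f=0\}\subset\Omega$ is smooth if there is no $\omega\in\Omega$ with $f(\omega)=0$ and $\partial f/\partial\omega_i(\omega)=0$ for all $i$. Two hypersurfaces intersect transversally in $\mathbb{R}^d$ if the points of intersection are smooth on the hypersurfaces and the corresponding tangent spaces at each intersection point generate the tangent space of $\mathbb{R}^d$ at that point. $\rho^{-1}$ denotes the inverse of the map $\rho$. The parameter $\lambda$ is positive, and the notation $V(\lambda)\approx C\lambda$ means $V(\lambda)=C\lambda+o(\lambda)$ as $\lambda\to0$.
   Formalization: The map ρ is assumed to be injective on Ω, so that the inverse ρ^{-1} used in C exists; nonvanishing of ∂f/∂ω_1 alone does not ensure this, and for a disconnected Ω the formula for C can otherwise be undefined or give the wrong constant. *)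

(* Defs.v *)
From HB Require Import structures.
From mathcomp Require Import all_boot all_order all_algebra finmap.
From mathcomp Require Import all_classical all_reals all_analysis.
From mathcomp.analysis.showcase Require Import summability.

Set Implicit Arguments.
Unset Strict Implicit.
Unset Printing Implicit Defensive.

Import Order.TTheory GRing.Theory Num.Theory.
Import numFieldNormedType.Exports.

Local Open Scope classical_set_scope.
Local Open Scope ring_scope.

(* Points of R^n are row vectors; the first coordinate has index ord0. *)

Section coordinates.
Context {R : realType} {n : nat}.

Definition cons_row (c : R) (y : 'rV[R]_n) : 'rV[R]_n.+1 :=
  row_mx (const_mx c : 'M[R]_1) y.

Definition behead_row (x : 'rV[R]_n.+1) : 'rV[R]_n := col' ord0 x.

Lemma cons_row0 c (y : 'rV[R]_n) : cons_row c y ord0 ord0 = c.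
Proof. by rewrite mxE; case: splitP => // j _; rewrite mxE. Qed.

Lemma cons_rowS c (y : 'rV[R]_n) j : cons_row c y ord0 (lift ord0 j) = y ord0 j.
Proof.
rewrite mxE; case: splitP => [[[|//] ?] //|k [jk]].
by congr (y _ _); exact: val_inj.
Qed.

Lemma cons_rowK (x : 'rV[R]_n.+1) : cons_row (x ord0 ord0) (behead_row x) = x.
Proof.
apply/rowP => i; case: (unliftP ord0 i) => [j ->|->].
  by rewrite cons_rowS mxE.
by rewrite cons_row0.
Qed.

Lemma behead_rowK c (y : 'rV[R]_n) : behead_row (cons_row c y) = y.
Proof. by apply/rowP => j; rewrite mxE cons_rowS. Qed.

End coordinates.

(* The library has no Lebesgue measure on R^n. R^n carries the sigma-algebra
   generated by the coordinate maps (the Borel sigma-algebra), and its Lebesgue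
   measure is the n-fold product of the one on R; on the one-point space R^0 it
   is the unit mass. *)

Definition rV_display : measure_display.
Proof. exact: default_measure_display. Qed.

Section measurable_rV.
Context {R : realType} {n : nat}.

Let coord (i : 'I_n) (x : 'rV[R]_n) : measurableTypeR R := x ord0 i.

Let rV_set0 : g_sigma_preimage coord set0.
Proof. exact: sigma_algebra0. Qed.

Let rV_setC A : g_sigma_preimage coord A -> g_sigma_preimage coord (~` A).
Proof. exact: sigma_algebraC. Qed.

Let rV_bigcup (F : _^nat) : (forall i, g_sigma_preimage coord (F i)) ->
  g_sigma_preimage coord (\bigcup_i (F i)).
Proof. exact: sigma_algebra_bigcup. Qed.

HB.instance Definition _ := @isMeasurable.Build rV_display
  'rV[R]_n (g_sigma_preimage coord) rV_set0 rV_setC rV_bigcup.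

Lemma measurable_coord (i : 'I_n) :
  measurable_fun setT (fun x : 'rV[R]_n => x ord0 i : measurableTypeR R).
Proof.
move=> _ Y mY; rewrite setTI; apply: sub_sigma_algebra => /=.
rewrite -bigcup_seq/=; exists i => /=; first by rewrite mem_index_enum.
by exists Y => //; rewrite setTI.
Qed.

Lemma measurable_fun_rV d (T : measurableType d) (f : T -> 'rV[R]_n) :
  (forall i, measurable_fun setT (fun t => f t ord0 i : measurableTypeR R)) ->
  measurable_fun setT f.
Proof.
move=> mf _ Y; rewrite setTI => mY.
suff : g_sigma_preimage coord `<=` image_set_system setT f measurable.
  by move=> /(_ Y mY); rewrite /image_set_system/= setTI.
apply: smallest_sub.
  exact/sigma_algebra_image/sigma_algebra_measurable.
rewrite -bigcup_seq => A [i _] [B mB <-].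
by rewrite /image_set_system/= !setTI; have := mf i measurableT B mB; rewrite setTI.
Qed.

End measurable_rV.

Section lebesgue_cons.
Context {R : realType} {n : nat}.

Definition cons_pair (p : measurableTypeR R * 'rV[R]_n) : 'rV[R]_n.+1 :=
  cons_row p.1 p.2.

Lemma measurable_cons_pair : measurable_fun setT cons_pair.
Proof.
apply: measurable_fun_rV => i; case: (unliftP ord0 i) => [j ->|->].
  under eq_fun do rewrite cons_rowS.
  exact: (measurableT_comp (measurable_coord j) measurable_snd).
under eq_fun do rewrite cons_row0.
exact: measurable_fst.
Qed.

Lemma measurable_behead_row :
  measurable_fun setT (behead_row : 'rV[R]_n.+1 -> 'rV[R]_n).
Proof.
apply: measurable_fun_rV => i.
under eq_fun do rewrite mxE.
exact: measurable_coord.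
Qed.

Variable mu : {sigma_finite_measure set 'rV[R]_n -> \bar R}.

Definition lebesgue_cons : set 'rV[R]_n.+1 -> \bar R :=
  pushforward (@lebesgue_measure R \x mu)%E cons_pair.

Let lebesgue_cons0 : lebesgue_cons set0 = 0%E.
Proof. by rewrite /lebesgue_cons /pushforward preimage_set0 measure0. Qed.

Let lebesgue_cons_ge0 A : (0 <= lebesgue_cons A)%E.
Proof. by rewrite /lebesgue_cons /pushforward; exact: measure_ge0. Qed.

Let lebesgue_cons_sigma_additive : semi_sigma_additive lebesgue_cons.
Proof.
move=> F mF tF mUF; rewrite /lebesgue_cons /pushforward preimage_bigcup.
apply: measure_semi_sigma_additive.
- by move=> k; rewrite -[X in measurable X]setTI; exact: measurable_cons_pair.
- apply/trivIsetP => /= i j _ _ ij; rewrite -preimage_setI.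
  by move/trivIsetP : tF => /(_ _ _ _ _ ij) ->//; rewrite preimage_set0.
- by rewrite -preimage_bigcup -[X in measurable X]setTI; exact: measurable_cons_pair.
Qed.

HB.instance Definition _ := isMeasure.Build _ _ _ lebesgue_cons
  lebesgue_cons0 lebesgue_cons_ge0 lebesgue_cons_sigma_additive.

Let lebesgue_cons_sigma_finite : sigma_finite setT lebesgue_cons.
Proof.
have /sigma_finiteP[F [TF ndF Foo]] := sigma_finiteT (@lebesgue_measure R).
have /sigma_finiteP[G [TG ndG Goo]] := sigma_finiteT mu.
exists (fun k => [set x : 'rV[R]_n.+1 | F k (x ord0 ord0) /\ G k (behead_row x)]).
  apply/seteqP; split => // x _.
  have [k _ Fkx] : (\bigcup_k F k) (x ord0 ord0) by rewrite -TF.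
  have [l _ Glx] : (\bigcup_k G k) (behead_row x) by rewrite -TG.
  exists (maxn k l) => //; split.
  - by move: Fkx; exact/subsetPset/ndF/leq_maxl.
  - by move: Glx; exact/subsetPset/ndG/leq_maxr.
move=> k; have [mFk Fkoo] := Foo k; have [mGk Gkoo] := Goo k; split.
  apply: measurableI; rewrite -[X in measurable X]setTI.
    exact: measurable_coord.
  exact: measurable_behead_row.
rewrite /lebesgue_cons /pushforward (_ : _ @^-1` _ = F k `*` G k).
  by rewrite product_measure1E// lte_mul_pinfty// ge0_fin_numE.
apply/seteqP; split => -[c y]; rewrite /preimage/= /cons_pair/=;
  by rewrite cons_row0 behead_rowK.
Qed.

HB.instance Definition _ := Measure_isSigmaFinite.Build _ _ _ lebesgue_cons
  lebesgue_cons_sigma_finite.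

End lebesgue_cons.

Fixpoint lebesgue_rV {R : realType} (n : nat) :
    {sigma_finite_measure set 'rV[R]_n -> \bar R} :=
  match n with
  | 0 => @dirac _ 'rV[R]_0 0 R
  | m.+1 => lebesgue_cons (lebesgue_rV m)
  end.

Lemma lebesgue_rV_box (R : realType) n (A : 'I_n -> set (measurableTypeR R)) :
  (forall i, measurable (A i)) ->
  lebesgue_rV n [set x : 'rV[R]_n | forall i, A i (x ord0 i)] =
  (\prod_(i < n) lebesgue_measure (A i))%E.
Proof.
elim: n A => [|n IH] A mA.
  rewrite big_ord0 /= diracE mem_set//= => -[] //.
rewrite big_ord_recl -IH// -product_measure1E//.
  congr (product_measure1 _ _ _); apply/seteqP; split => -[c y]/=.
    move=> H; split; first by have := H ord0; rewrite /cons_pair cons_row0.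
    by move=> i; have := H (lift ord0 i); rewrite /cons_pair cons_rowS.
  move=> [cA yA] i; rewrite /cons_pair; case: (unliftP ord0 i) => [j ->|->].
    by rewrite cons_rowS; exact: yA.
  by rewrite cons_row0.
rewrite [X in measurable X](_ : _ =
    \bigcap_(i in [set: 'I_n]) ((fun x : 'rV[R]_n => x ord0 i) @^-1` A (lift ord0 i))).
  apply: fin_bigcap_measurable => // i _.
  by rewrite -[X in measurable X]setTI; exact: measurable_coord.
apply/seteqP; split => x /= H i; first by move=> _; exact: H.
exact: (H i I).
Qed.

Section analytic.
Context {R : realType} {n : nat}.
Implicit Types (f g : 'rV[R]_n -> R) (p x v : 'rV[R]_n) (A S : set 'rV[R]_n).

(* f is the sum of a power series on a neighbourhood of p in R^n. The series is
   indexed by multi-indices and summed unconditionally (equivalently,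
   absolutely), along the filter of finite sets of multi-indices. *)
Definition analytic_at f p := exists a : {ffun 'I_n -> nat} -> R,
  \forall x \near p,
    partial_sum (fun m : {ffun 'I_n -> nat} =>
      a m * \prod_(i < n) ((x : 'rV[R]_n) ord0 i - p ord0 i) ^+ m i) @ totally --> f x.

(* Amounts to analyticity on an open neighbourhood of A in R^n. *)
Definition analytic_on A f := forall p, A p -> analytic_at f p.

(* Near each point of R^n, A is a finite union of sets given by finitely many
   equations g i j = 0 and strict inequalities 0 < h i j between functions
   analytic there. A common number l of equations and inequalities is no
   restriction: pad with g i j = 0 and h i j = 1. *)
Definition semianalytic A := forall p : 'rV[R]_n,
  exists (k l : nat) (g h : 'I_k -> 'I_l -> 'rV[R]_n -> R),
    (forall i j, analytic_at (g i j) p /\ analytic_at (h i j) p) /\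
    \forall x \near p,
      A x <-> exists i, forall j, g i j x = 0 /\ 0 < h i j x.

Definition full_dimensional A := A° !=set0.

Definition boundary A := closure A `\` A°.

Definition partial f (i : 'I_n) x : R := 'D_(delta_mx ord0 i : 'rV[R]_n) f x.

Definition singular_at f x := forall i, partial f i x = 0.

Definition smooth_hypersurface A f :=
  ~ exists x, [/\ A x, f x = 0 & singular_at f x].

(* Meaningful when x is a smooth point of the hypersurface {f = 0}. *)
Definition tangent_space f x : set 'rV[R]_n :=
  [set v : 'rV[R]_n | \sum_(i < n) partial f i x * v ord0 i = 0].

(* x is a smooth point of S: near x, S is the hypersurface {g = 0}. The tangent
   space of S at x is then tangent_space g x, which does not depend on g. *)
Definition local_equation S g x :=
  [/\ analytic_at g x, \forall y \near x, S y <-> g y = 0 & ~ singular_at g x].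

(* S, seen as a hypersurface, against {f = 0} inside A. *)
Definition intersects_transversally S A f := forall x, S x -> A x -> f x = 0 ->
  ~ singular_at f x /\
  exists2 g, local_equation S g x &
    forall v, exists u w, [/\ tangent_space f x u, tangent_space g x w & v = u + w].

End analytic.

Section tube.
Context {R : realType} {n : nat}.
Implicit Types (Omega : set 'rV[R]_n.+1) (f phi : 'rV[R]_n.+1 -> R).

Definition rho f (x : 'rV[R]_n.+1) : 'rV[R]_n.+1 := cons_row (f x) (behead_row x).

Definition hypersurface_proj Omega f : set 'rV[R]_n :=
  behead_row @` (Omega `&` [set x | f x = 0]).

Definition tube_integral Omega f phi (lambda : R) : R :=
  \int[lebesgue_rV n.+1]_(x in Omega `&` [set x | `|f x| <= lambda]) phi x.

Definition tube_constant Omega f phi (rhoinv : 'rV[R]_n.+1 -> 'rV[R]_n.+1) : R :=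
  2 * \int[lebesgue_rV n]_(y in hypersurface_proj Omega f)
        ((fun x => phi x / `|partial f ord0 x|) \o rhoinv) (cons_row 0 y).

End tube.

(* Main.v *)
Require Import Defs.
From mathcomp Require Import all_boot all_order all_algebra finmap.
From mathcomp Require Import all_classical all_reals all_analysis.
From mathcomp.analysis.showcase Require Import summability.
From mathcomp Require Import measurable_realfun ring lra.

(** Slice the tube along the vertical lines [s |-> (s, y)]. Analyticity enters
    only through strict differentiability: near a point, [f x - f y] is the
    differential at that point applied to [x - y], up to [e * |x - y|]. Together
    with the injectivity of [rho] and the compactness of [Omega] it gives
    [c * |s - t| <= |f (s, y) - f (t, y)|] on [Omega], so the slice of
    [{|f| <= l}] over [y] has length [O(l)], uniformly in [y]. Over a point [y]
    whose zero is interior to [Omega], the slice integral divided by [2 * l] tends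
    to [phi / |df/dw_1|] at that zero; over [y] outside [W] it vanishes for small
    [l]. By transversality, the zeros on the boundary of [Omega] project to a null
    set: near each of them, some line direction of R^(d-1) meets the projection in
    at most one point. Dominated convergence concludes. *)

Set Implicit Arguments.
Unset Strict Implicit.
Unset Printing Implicit Defensive.

Import Order.TTheory GRing.Theory Num.Theory.
Import numFieldNormedType.Exports.

Local Open Scope classical_set_scope.
Local Open Scope ring_scope.

(** * Strict differentiability of analytic functions *)

Lemma rV_nearP (R : realType) n (p : 'rV[R]_n) (P : 'rV[R]_n -> Prop) :
  (\forall x \near p, P x) <->
  exists2 d : R, 0 < d & forall x, `|x - p| < d -> P x.
Proof.
split.
  move=> /nbhs_normP [d d0 H]; exists d => // x xp; apply: H.
  by rewrite /ball_/= distrC.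
move=> [d d0 H]; apply/(@nbhs_normP _ 'rV[R]_n p); exists d => // x.
by rewrite /ball_/= distrC; exact: H.
Qed.

Lemma rV_continuousP (R : realType) n (f : 'rV[R]_n -> R) (p : 'rV[R]_n) :
  f x @[x --> p] --> f p <->
  forall e, 0 < e ->
    exists2 d, 0 < d & forall x, `|x - p| < d -> `|f x - f p| < e.
Proof.
split.
  move=> /(@cvgrPdist_lt _ _ _ (nbhs p)) H e /H /rV_nearP [d d0 h].
  by exists d => // x /h; rewrite distrC.
move=> H; apply/(@cvgrPdist_lt _ _ _ (nbhs p)) => e /H [d d0 h].
by apply/rV_nearP; exists d => // x /h; rewrite distrC.
Qed.

Lemma rV_within_continuousP (R : realType) n (A : set 'rV[R]_n)
    (f : 'rV[R]_n -> R) :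
  {within A, continuous f} <->
  forall p, A p -> forall e, 0 < e ->
    exists2 d, 0 < d & forall x, A x -> `|x - p| < d -> `|f x - f p| < e.
Proof.
split.
  move=> /subspace_continuousP H p /H.
  move=> /(@cvgrPdist_lt _ _ _ (within A (nbhs p))) {}H e /H /rV_nearP [d d0 h].
  by exists d => // x Ax /h; rewrite distrC; exact.
move=> H; apply/subspace_continuousP => p /H {}H.
apply/(@cvgrPdist_lt _ _ _ (within A (nbhs p))) => e /H [d d0 h].
by apply/rV_nearP; exists d => // x /h xd Ax; rewrite distrC xd.
Qed.

(** Beyond some finite [J0] the partial sums stay within [1] of [l], so a finite set disjoint from
    [J0] has a sum of absolute value at most [2]. Splitting such a set by the sign of [c] bounds its
    absolute sum by [4]. *)
Lemma unconditional_abs_bounded (R : realType) (I : choiceType) (c : I -> R)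
    (l : R) :
  partial_sum c @ totally --> l ->
  exists B, 0 <= B /\ forall J : {fset I}, \sum_(m <- J) `|c m| <= B.
Proof.
have FF := @totally_filter I.
move=> /cvgrPdist_lt /(_ 1 ltr01) [J0 _ HJ0].
have P J : (J0 `<=` J)%fset -> `|l - \sum_(m <- J) c m| < 1.
  by move=> /HJ0; rewrite /= /partial_sum big_seq_fsetE.
have small (J : {fset I}) : [disjoint J0 & J]%fset -> `|\sum_(m <- J) c m| <= 2.
  move=> dJ.
  have h1 := P J0 (fsubset_refl _).
  have h2 := P (J0 `|` J)%fset (fsubsetUl _ _).
  have e : \sum_(m <- (J0 `|` J)%fset) c m = \sum_(m <- J0) c m + \sum_(m <- J) c m.
    rewrite -big_cat; apply: perm_big; apply: uniq_perm; first exact: fset_uniq.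
      rewrite cat_uniq !fset_uniq /= andbT; apply/hasPn => x xJ.
      by move/fdisjointP: dJ => dJ; apply/negP => /dJ; rewrite xJ.
    by move=> x; rewrite mem_cat in_fsetU.
  rewrite e in h2.
  have -> : \sum_(m <- J) c m = (l - \sum_(m <- J0) c m)
     - (l - (\sum_(m <- J0) c m + \sum_(m <- J) c m)) by ring.
  rewrite (le_trans (ler_normB _ _))//; lra.
exists (\sum_(m <- J0) `|c m| + 4); split; first by rewrite addr_ge0// sumr_ge0.
move=> J; rewrite (bigID (fun m => m \in J0))/= lerD//.
  rewrite -big_filter [leRHS](bigID (fun m => m \in J))/= -[leLHS]addr0 lerD ?sumr_ge0//.
  rewrite -[leRHS]big_filter le_eqVlt; apply/orP; left; apply/eqP/perm_big.
  apply: uniq_perm; rewrite ?filter_uniq// => x.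
  by rewrite !mem_filter andbC.
rewrite (bigID (fun m => 0 <= c m))/=.
have part (Q : pred I) : (forall m, Q m -> m \notin J0) ->
    `|\sum_(m <- J | Q m) c m| <= 2.
  move=> QJ.
  have := small [fset m in J | Q m]%fset.
  rewrite big_fset/= => -> //.
  apply/fdisjointP => x xJ0; rewrite !inE /=; apply/negP => /andP[_ /QJ].
  by rewrite xJ0.
rewrite (eq_bigr (fun m => c m)); last by move=> m /andP[_ ?]; rewrite ger0_norm.
rewrite [X in _ + X](eq_bigr (fun m => - c m)); last first.
  by move=> m /andP[_]; rewrite -ltNge => ?; rewrite ltr0_norm.
rewrite sumrN.
have := part (fun m => (m \notin J0) && (0 <= c m)) (fun m H => proj1 (andP H)).
have := part (fun m => (m \notin J0) && ~~ (0 <= c m)) (fun m H => proj1 (andP H)).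
by rewrite !ler_norml => /andP[? ?] /andP[? ?]; lra.
Qed.

(** Mean value estimate for monomials, by telescoping one factor at a time. The factor [rho] on the
    left avoids an exponent one below the degree on the right, which would single out degree [0]. *)
Lemma monomial_sub_le (R : realType) n (u v : 'I_n -> R) (rho D : R)
    (m : 'I_n -> nat) :
  0 <= rho -> (forall i, `|u i| <= rho) -> (forall i, `|v i| <= rho) ->
  (forall i, `|u i - v i| <= D) ->
  rho * `|\prod_(i < n) u i ^+ m i - \prod_(i < n) v i ^+ m i| <=
  (\sum_(i < n) m i)%:R * rho ^+ (\sum_(i < n) m i) * D.
Proof.
move=> rho0 urho vrho uvD.
pose P (U V : R) (k : nat) := [/\ `|U| <= rho ^+ k, `|V| <= rho ^+ k &
  rho * `|U - V| <= k%:R * rho ^+ k * D].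
have PM U V k U' V' k' : P U V k -> P U' V' k' -> P (U * U') (V * V') (k + k')%N.
  move=> [Uk Vk UV] [Uk' Vk' UV']; split.
  - by rewrite normrM exprD ler_pM.
  - by rewrite normrM exprD ler_pM.
  - have -> : U * U' - V * V' = (U - V) * U' + V * (U' - V') by ring.
    apply: (@le_trans _ _
      (rho * `|U - V| * rho ^+ k' + rho ^+ k * (rho * `|U' - V'|))).
      apply: (@le_trans _ _ (rho * (`|U - V| * `|U'| + `|V| * `|U' - V'|))).
        by rewrite ler_wpM2l// -!normrM ler_normD.
      rewrite mulrDr lerD//; first by rewrite mulrA ler_wpM2l// mulr_ge0.
      by rewrite mulrCA ler_wpM2r// mulr_ge0.
    apply: (@le_trans _ _ ((k%:R * rho ^+ k * D) * rho ^+ k' +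
      rho ^+ k * (k'%:R * rho ^+ k' * D))).
      by rewrite lerD// ?ler_wpM2r ?ler_wpM2l ?exprn_ge0.
    by rewrite natrD exprD le_eqVlt; apply/orP; left; apply/eqP; ring.
have P1 : P 1 1 0%N by split; rewrite ?normr1 ?expr0// subrr normr0 mulr0 mul0r mul0r.
suff [] : P (\prod_(i < n) u i ^+ m i) (\prod_(i < n) v i ^+ m i)
  (\sum_(i < n) m i)%N by [].
apply: (big_ind3 P) => //.
move=> i _; elim: (m i) => [|k IH]; first by rewrite !expr0.
rewrite !exprS -add1n; apply: PM => //; split => //.
by rewrite mul1r expr1 ler_wpM2l.
Qed.

(** Passing from [k] to [k + 1] multiplies the left side by [t * (k + 1) / k], at most [1] when
    [t <= 1/2]. This makes the terms of degree at least two quadratically small. *)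
Lemma natr_mul_expr_le (R : realType) (t : R) (k : nat) :
  0 <= t -> t <= 2^-1 -> (2 <= k)%N -> k%:R * t ^+ k <= 2 * t ^+ 2.
Proof.
move=> t0 t2; elim: k => // k IH; rewrite ltnS leq_eqVlt => /orP[/eqP<-//|k2].
apply: le_trans (IH k2); rewrite exprS mulrA ler_wpM2r ?exprn_ge0//.
apply: (@le_trans _ _ (k.+1%:R * 2^-1)); first by rewrite ler_wpM2l.
rewrite ler_pdivrMr// -natrM ler_nat muln2 -addnn -addn1 leq_add2l.
by apply: ltnW.
Qed.
Lemma rV_coord_le (R : realType) n (x : 'rV[R]_n) i : `|x ord0 i| <= `|x|.
Proof.
rewrite [leRHS]/Num.norm /= mx_normrE; apply/bigmax_geP; right => /=.
by exists (ord0, i).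
Qed.

Lemma rV_norm_le (R : realType) n (x : 'rV[R]_n) (e : R) :
  0 <= e -> (forall i, `|x ord0 i| <= e) -> `|x| <= e.
Proof.
move=> e0 xe; rewrite [leLHS]/Num.norm /= mx_normrE; apply/bigmax_leP; split => //=.
by move=> [i j] _ /=; rewrite (ord1 i).
Qed.

(* Uniform in both points near [p], so it encodes the differential together with
   its continuity at [p]. *)
Definition strict_gradient (R : realType) n (f : 'rV[R]_n -> R) (p : 'rV[R]_n)
    (a : 'I_n -> R) := forall e, 0 < e -> exists2 d, 0 < d &
  forall x y, `|x - p| < d -> `|y - p| < d ->
  `|f x - f y - \sum_(i < n) a i * (x ord0 i - y ord0 i)| <= e * `|x - y|.

(** The gradient consists of the coefficients of degree one. The series converges absolutely at
    distance [s]; on the smaller radius [t * s] its terms of degree at least two have a Lipschitz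
    constant of order [t]. *)
Lemma analytic_strict_gradient (R : realType) n (f : 'rV[R]_n -> R) p :
  analytic_at f p -> exists a, strict_gradient f p a.
Proof.
move=> [a /nbhs_normP[r /= r0 fr]].
pose mon (x : 'rV[R]_n) (m : {ffun 'I_n -> nat}) :=
  \prod_(i < n) (x ord0 i - p ord0 i) ^+ m i.
have {}fr x : `|x - p| < r ->
  partial_sum (fun m => a m * mon x m) @ totally --> f x.
  by rewrite distrC; exact: fr.
pose deg (m : {ffun 'I_n -> nat}) := (\sum_(i < n) m i)%N.
pose s := r / 2.
have s0 : 0 < s by rewrite divr_gt0.
have sr : s < r by rewrite /s; lra.
(* At the corner [p + (s, ..., s)] every monomial equals [s ^ deg m]. *)
have [B [B0 HB]] : exists B, 0 <= B /\
    forall J : {fset {ffun 'I_n -> nat}}, \sum_(m <- J) `|a m| * s ^+ deg m <= B.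
  have /fr : `|(p + const_mx s) - p| < r.
    rewrite addrC addKr; apply: le_lt_trans sr; apply: rV_norm_le (ltW s0) _ => i.
    by rewrite mxE gtr0_norm.
  move=> /unconditional_abs_bounded[B [B0 HB]]; exists B; split => // J.
  apply: le_trans (HB J); rewrite le_eqVlt; apply/orP; left; apply/eqP.
  apply: eq_bigr => m _; rewrite normrM; congr (_ * _).
  rewrite /mon /deg (eq_bigr (fun i => s ^+ m i)); last first.
    by move=> i _; rewrite !mxE; congr (_ ^+ _); ring.
  by rewrite -expr_sum gtr0_norm// exprn_gt0.
pose unit_index (i : 'I_n) : {ffun 'I_n -> nat} := [ffun j => (j == i : nat)].
have unit_index_inj : injective unit_index.
  move=> i j /ffunP/(_ i); rewrite !ffunE eqxx; by case: eqP.
have mon_unit x i : mon x (unit_index i) = x ord0 i - p ord0 i.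
  rewrite /mon (bigD1 i)//= ffunE eqxx expr1 big1 ?mulr1// => j ji.
  by rewrite ffunE (negbTE ji) expr0.
have deg_unit m : deg m = 1%N -> m \in codom unit_index.
  move=> /eqP/sum_nat_eq1[i [_ mi mj]]; apply/codomP; exists i.
  apply/ffunP => j; rewrite ffunE; case: (eqVneq j i) => [->//|ji].
  by rewrite mj.
exists (fun i => a (unit_index i)) => e e0.
(* Chosen so that [2 * t / s * B <= e]. Here [B + 1] avoids a zero denominator, and [1/2] is the
   range of [natr_mul_expr_le]. *)
pose t := Num.min (2^-1) (e * s / (2 * (B + 1))).
have B10 : 0 < B + 1 by lra.
have t0 : 0 < t.
  by rewrite lt_min invr_gt0 ltr0n/= divr_gt0// ?mulr_gt0.
have t2 : t <= 2^-1 by rewrite ge_min lexx.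
have te : 2 * t / s * B <= e.
  have : t <= e * s / (2 * (B + 1)) by rewrite ge_min lexx orbT.
  rewrite ler_pdivlMr ?mulr_gt0// => te.
  rewrite mulrAC ler_pdivrMr//; nra.
pose rho := t * s.
have rho0 : 0 < rho by rewrite mulr_gt0.
have rhor : rho < r by rewrite /rho; nra.
exists rho => // x y xp yp.
set L := \sum_(i < n) _.
pose S x := partial_sum (fun m : {ffun 'I_n -> nat} => a m * mon x m).
have FF := @totally_filter {ffun 'I_n -> nat}.
have cvgS : (fun J => S x J - S y J - L) @ totally --> f x - f y - L.
  apply: cvgB; last exact: cvg_cst.
  by apply: cvgB; apply: fr; apply: lt_trans rhor.
(* The bound is a closed condition on the limit, so it suffices to prove it for sums over finite
   sets that contain all multi-indices of degree one. *)
apply: (@closed_cvg _ _ _ _ _ ((fun z : R => `|z|) @^-1` [set z | z <= e * `|x - y|])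
    _ _ _ cvgS).
  by apply: closed_comp; [move=> z _; exact: norm_continuous|exact: closed_le].
pose J1 := [fset m in codom unit_index]%fset.
exists J1 => // J /= /fsubsetP J1J.
have -> : S x J - S y J - L =
    \sum_(m <- J | m \notin codom unit_index) a m * (mon x m - mon y m).
  have partial_sumE z : S z J = \sum_(m <- J) a m * mon z m.
    by rewrite big_seq_fsetE.
  rewrite !partial_sumE -sumrB.
  rewrite (bigID (fun m => m \in codom unit_index))/= addrAC.
  rewrite [X in X - L](_ : _ = L) ?subrr ?add0r.
    by apply: eq_bigr => m _; ring.
  rewrite -big_filter (perm_big (codom unit_index)); last first.
    apply: uniq_perm; rewrite ?filter_uniq ?fset_uniq//.
      by rewrite /codom /image_mem map_inj_uniq// enum_uniq.
    move=> m; rewrite mem_filter andb_idr// => mc.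
    by apply: J1J; rewrite !inE.
  rewrite /codom /image_mem big_map big_enum/=; apply: eq_bigr => i _.
  by rewrite !mon_unit; ring.
apply: le_trans (ler_norm_sum _ _ _) _.
apply: (@le_trans _ _ (2 * t / s * B * `|x - y|)); last by rewrite ler_wpM2r.
apply: (@le_trans _ _ (\sum_(m <- J) (`|a m| * s ^+ deg m) * (2 * t / s * `|x - y|))).
  rewrite big_mkcond; apply: ler_sum => m _; case: ifP => mc; last first.
    by rewrite !mulr_ge0// ?exprn_ge0 ?invr_ge0 ?ltW.
  rewrite normrM -mulrA ler_wpM2l//.
  have mono : rho * `|mon x m - mon y m| <= (deg m)%:R * rho ^+ deg m * `|x - y|.
    apply: monomial_sub_le; rewrite ?ltW// => i.
    - by have := rV_coord_le (x - p) i; rewrite !mxE => /le_trans; apply; exact: ltW.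
    - by have := rV_coord_le (y - p) i; rewrite !mxE => /le_trans; apply; exact: ltW.
    - have := rV_coord_le (x - y) i; rewrite !mxE => h.
      by rewrite opprB addrA subrK.
  rewrite -(ler_pM2l rho0); apply: le_trans mono _.
  rewrite mulrA mulrA ler_wpM2r//.
  have -> : rho * s ^+ deg m * (2 * t / s) = s ^+ deg m * (2 * t ^+ 2).
    by rewrite /rho; field; rewrite gt_eqF.
  rewrite /rho exprMn mulrA mulrC ler_wpM2l ?exprn_ge0 ?(ltW s0)//.
  (* Degree [0] contributes nothing to a difference, and degree [1] is excluded by [mc]. *)
  case E : (deg m) => [|[|k]].
  - by rewrite mul0r mulr_ge0// exprn_ge0// (ltW t0).
  - by rewrite deg_unit in mc.
  - by apply: natr_mul_expr_le => //; exact: ltW.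
rewrite -mulr_suml [leRHS]mulrAC [leRHS]mulrC.
by rewrite ler_wpM2r// !mulr_ge0// ?invr_ge0 ltW.
Qed.

Lemma partial_strict (R : realType) n (f : 'rV[R]_n -> R) p a i :
  strict_gradient f p a -> partial f i p = a i.
Proof.
move=> fa; rewrite /partial /derive; apply: cvg_lim => //.
apply/cvgrPdist_le => e e0.
have [d d0 fd] := fa e e0.
near=> h.
have h0 : h != 0 by near: h; exact: nbhs_dnbhs_neq.
have nd : `|delta_mx ord0 i : 'rV[R]_n| <= 1.
  apply: rV_norm_le => // j; rewrite mxE eqxx/=.
  by case: (_ == _); rewrite ?normr1 ?normr0.
have hd : `|h *: delta_mx ord0 i + p - p : 'rV[R]_n| <= `|h|.
  by rewrite addrK normrZ ler_piMr.
have hd' : `|h| < d by near: h; exact: dnbhs0_lt.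
have := fd (h *: delta_mx ord0 i + p) p (le_lt_trans hd hd').
rewrite subrr normr0 => /(_ d0).
rewrite (bigD1 i)//= big1 ?addr0; last first.
  by move=> j ji; rewrite !mxE (negbTE ji) andbF mulr0 add0r subrr mulr0.
rewrite !mxE !eqxx mulr1 addrK => H.
have -> : a i - h^-1 *: (f (h *: delta_mx ord0 i + p) - f p) =
   - h^-1 * (f (h *: delta_mx ord0 i + p) - f p - a i * h).
  by rewrite /GRing.scale/=; field.
rewrite normrM normrN normfV mulrC ler_pdivrMr ?normr_gt0//.
apply: le_trans H _; rewrite ler_wpM2l//; exact: ltW.
Unshelve. all: by end_near.
Qed.

Lemma analytic_strict (R : realType) n (f : 'rV[R]_n -> R) p :
  analytic_at f p -> strict_gradient f p (fun i => partial f i p).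
Proof.
move=> /analytic_strict_gradient[a fa]; rewrite (_ : (fun i => _) = a)//.
by apply/funext => i; exact: partial_strict fa.
Qed.

Lemma strict_gradient_continuous (R : realType) n (f : 'rV[R]_n -> R) p a :
  strict_gradient f p a -> f x @[x --> p] --> f p.
Proof.
move=> fa; apply/rV_continuousP => e e0.
have [d d0 fd] := fa 1 ltr01.
pose M := 1 + \sum_i `|a i|.
have M0 : 0 < M by rewrite /M ltr_pwDl// sumr_ge0.
exists (Num.min d (e / M)); first by rewrite lt_min d0 divr_gt0.
move=> x; rewrite lt_min => /andP[xd xe].
have := fd x p xd; rewrite subrr normr0 => /(_ d0).
set L := \sum_i _ => H.
have HL : `|L| <= (\sum_i `|a i|) * `|x - p|.
  apply: le_trans (ler_norm_sum _ _ _) _; rewrite mulr_suml; apply: ler_sum => i _.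
  by rewrite normrM ler_wpM2l//; have := rV_coord_le (x - p) i; rewrite !mxE.
have -> : f x - f p = (f x - f p - L) + L by ring.
apply: le_lt_trans (ler_normD _ _) _.
apply: (@le_lt_trans _ _ (M * `|x - p|)); first by rewrite /M mulrDl lerD.
by rewrite mulrC -ltr_pdivlMr.
Qed.

(** The strict estimates at [p] and at [x] are compared on one increment from [x] along axis [i].
    Both linearise the same difference of values, so the two partial derivatives differ by at most
    [2 * e / 3]. *)
Lemma partial_continuous (R : realType) n (f : 'rV[R]_n -> R) (A : set 'rV[R]_n) i :
  analytic_on A f -> {within A, continuous (partial f i)}.
Proof.
move=> fA; apply/rV_within_continuousP => p Ap e e0.
have e3 : 0 < e / 3 by rewrite divr_gt0.
have [d d0 fd] := analytic_strict (fA p Ap) e3.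
exists d => // x Ax xd.
have [d' d'0 fd'] := analytic_strict (fA x Ax) e3.
(* Small enough for the shifted point [y] to lie in the balls of both estimates. *)
pose h := Num.min d' (d - `|x - p|) / 2.
have h0 : 0 < h by rewrite divr_gt0// lt_min d'0 subr_gt0.
have hd' : h < d'.
  have : Num.min d' (d - `|x - p|) <= d' by rewrite ge_min lexx.
  by rewrite /h; lra.
have hd : `|x - p| + h < d.
  have : Num.min d' (d - `|x - p|) <= d - `|x - p| by rewrite ge_min lexx orbT.
  by rewrite /h in h0 *; lra.
pose y := x + h *: delta_mx ord0 i.
have yx : `|y - x| <= h.
  rewrite /y addrAC subrr add0r; apply: rV_norm_le => [|j]; first exact: ltW.
  rewrite !mxE eqxx/=; case: (_ == _); rewrite ?mulr1 ?mulr0 ?normr0 ?(ltW h0)//.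
  by rewrite gtr0_norm.
have yp : `|y - p| < d.
  apply: le_lt_trans (ler_distD x _ _) _; rewrite addrC.
  by apply: le_lt_trans hd; rewrite lerD2l.
have E q : \sum_(j < n) partial f j q * (y ord0 j - x ord0 j) = partial f i q * h.
  rewrite (bigD1 i)//= big1 ?addr0.
    by rewrite !mxE !eqxx mulr1 [X in X - _]addrC addrK.
  by move=> j ji; rewrite !mxE (negbTE ji) andbF mulr0 addr0 subrr mulr0.
have H1 := fd y x yp xd; rewrite E in H1.
have H2 := fd' y x (le_lt_trans yx hd'); rewrite subrr normr0 E in H2.
move/(_ d'0) in H2.
rewrite distrC -(ltr_pM2r h0) -[X in _ * X < _](gtr0_norm h0) -normrM.
have -> : (partial f i p - partial f i x) * h =
  (f y - f x - partial f i x * h) - (f y - f x - partial f i p * h) by ring.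
apply: le_lt_trans (ler_normB _ _) _.
nra.
Qed.

(** * Lebesgue measure on row vectors *)

(** An open set is the union of the boxes of rational centre and radius [1 / (k + 1)] that it
    contains, and these are countably many. *)
Lemma open_measurable_rV (R : realType) n (U : set 'rV[R]_n) :
  open U -> measurable U.
Proof.
move=> oU.
pose box (qk : 'rV[rat]_n * nat) := [set x : 'rV[R]_n |
  forall i, `|x ord0 i - ratr (qk.1 ord0 i)| < qk.2.+1%:R^-1].
have -> : U = \bigcup_(qk in [set qk | box qk `<=` U]) box qk.
  apply/seteqP; split => [x Ux|x [qk + bx]]; last exact.
  have /rV_nearP[d d0 dU] : \forall y \near x, U y by exact: open_nbhs_nbhs.
  have [k kd] : exists k : nat, 2 * k.+1%:R^-1 < d.
    have /ltr_add_invr[k] : 0 < d / 2 by rewrite divr_gt0.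
    by rewrite add0r => h; exists k; rewrite mulrC -ltr_pdivlMr.
  have k0 : 0 < k.+1%:R^-1 :> R by rewrite invr_gt0.
  set e : R := k.+1%:R^-1 in kd k0.
  have qi i : exists q : rat, `|x ord0 i - ratr q| < e.
    have /rat_in_itvoo[q] : x ord0 i - e < x ord0 i + e by lra.
    by rewrite in_itv/= => /andP[? ?]; exists q; rewrite ltr_norml; lra.
  pose q : 'rV[rat]_n := \row_i sval (cid (qi i)).
  exists (q, k) => /=; last by move=> i; rewrite mxE; case: cid.
  move=> y by_; apply: dU; apply: le_lt_trans kd.
  apply: rV_norm_le => [|i]; first by rewrite mulr_ge0// ltW.
  rewrite !mxE; have := by_ i; rewrite /= mxE -/e; case: cid => z /= xz yz.
  have -> : y ord0 i - x ord0 i = (y ord0 i - ratr z) - (x ord0 i - ratr z) by ring.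
  by apply: le_trans (ler_normB _ _) _; lra.
rewrite bigcup_mkcond; apply: countable_bigcupT_measurable.
  exact: countableP.
move=> qk; case: ifP => // _.
rewrite (_ : box qk = \bigcap_(i in [set: 'I_n])
    ((fun x : 'rV[R]_n => x ord0 i) @^-1` ball (ratr (qk.1 ord0 i) : R) qk.2.+1%:R^-1)).
  apply: fin_bigcap_measurable => // i _.
  rewrite -[X in measurable X]setTI; apply: measurable_coord => //.
  exact: measurable_ball.
apply/seteqP; split => x /= H i; first by move=> _; rewrite /ball/= distrC; exact: H.
by have := H i I; rewrite /= /ball/= distrC.
Qed.

Lemma closed_measurable_rV (R : realType) n (K : set 'rV[R]_n) :
  closed K -> measurable K.
Proof.
move=> cK; rewrite -(setCK K); apply: measurableC; apply: open_measurable_rV.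
exact: closed_openC.
Qed.

Lemma compact_closed_rV (R : realType) n (K : set 'rV[R]_n) : compact K -> closed K.
Proof. by apply: compact_closed; exact: norm_hausdorff. Qed.

Lemma compact_measurable_rV (R : realType) n (K : set 'rV[R]_n) :
  compact K -> measurable K.
Proof. by move=> /compact_closed_rV; exact: closed_measurable_rV. Qed.

Section fubini_rV.
Context {R : realType} {n : nat}.
Variable F : 'rV[R]_n.+1 -> \bar R.
Hypotheses (mF : measurable_fun setT F) (F0 : forall x, (0 <= F x)%E).

Let mFc : measurable_fun setT (F \o cons_pair).
Proof. exact: measurableT_comp measurable_cons_pair. Qed.

Let integral_cons_pair :
  (\int[lebesgue_rV n.+1]_x F x =
   \int[(@lebesgue_measure R \x lebesgue_rV n)%E]_p (F \o cons_pair) p)%E.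
Proof.
exact: (ge0_integral_pushforward (measurable_cons_pair)
  ((@lebesgue_measure R \x lebesgue_rV n)%E) measurableT mF (fun y _ => F0 y)).
Qed.

Lemma integral_rV_cons :
  (\int[lebesgue_rV n.+1]_x F x =
   \int[lebesgue_rV n]_y \int[lebesgue_measure]_s F (cons_row s y))%E.
Proof.
rewrite integral_cons_pair (fubini_tonelli2 (F \o cons_pair))// => p; exact: F0.
Qed.

Lemma integral_rV_cons_swap :
  (\int[lebesgue_rV n.+1]_x F x =
   \int[lebesgue_measure]_s \int[lebesgue_rV n]_y F (cons_row s y))%E.
Proof.
rewrite integral_cons_pair (fubini_tonelli1 (F \o cons_pair))// => p; exact: F0.
Qed.

Lemma measurable_integral_cons : measurable_fun setT
  (fun y => \int[lebesgue_measure]_s F (cons_row s y))%E.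
Proof.
by apply: (measurable_fun_fubini_tonelli_G (F \o cons_pair)) => // p; exact: F0.
Qed.

End fubini_rV.

Lemma measurable_cons_row_left (R : realType) n (y : 'rV[R]_n) :
  measurable_fun setT (fun s : measurableTypeR R => cons_row s y).
Proof.
rewrite -[f in measurable_fun _ f]/(cons_pair \o
  (fun s : measurableTypeR R => (s, y))).
apply: measurableT_comp; first exact: measurable_cons_pair.
exact: measurable_pair2.
Qed.

Lemma measurable_cons_row_right (R : realType) n (s : R) :
  measurable_fun setT (fun y : 'rV[R]_n => cons_row s y).
Proof.
rewrite -[f in measurable_fun _ f]/(cons_pair \o
  (fun y : 'rV[R]_n => (s : measurableTypeR R, y))).
apply: measurableT_comp; first exact: measurable_cons_pair.
exact: measurable_pair1.
Qed.

(** By induction on the dimension, with Tonelli on the first coordinate. If [j] is that coordinate,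
    the slices along it have at most one point; otherwise the slices at a fixed first coordinate
    satisfy the same hypothesis one dimension lower. *)
Lemma null_of_lines (R : realType) n (A : set 'rV[R]_n) (j : 'I_n) :
  measurable A ->
  (forall x y, A x -> A y -> (forall i, i != j -> x ord0 i = y ord0 i) ->
    x ord0 j = y ord0 j) ->
  lebesgue_rV n A = 0%E.
Proof.
elim: n A j => [A []//|n IH] A j mA line.
have mF : measurable_fun setT (EFin \o (\1_A : 'rV[R]_n.+1 -> R)).
  by apply/measurable_EFinP; exact: measurable_indic.
have F0 (x : 'rV[R]_n.+1) : (0 <= (\1_A x)%:E :> \bar R)%E by rewrite lee_fin.
rewrite -[A]setIT -integral_indic//.
case: (unliftP ord0 j) => [k jk|j0].
- rewrite integral_rV_cons_swap//; apply: integral0_eq => s _.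
  have mB : measurable ((fun y : 'rV[R]_n => cons_row s y) @^-1` A).
    by rewrite -[X in measurable X]setTI; exact: measurable_cons_row_right.
  have := integral_indic (lebesgue_rV n) measurableT mB; rewrite setIT => ->.
  apply: (IH _ k) => // x y /= Ax Ay xy.
  have := line _ _ Ax Ay; rewrite jk !cons_rowS; apply => i.
  case: (unliftP ord0 i) => [l ->|->]; last by rewrite !cons_row0.
  by rewrite (inj_eq lift_inj) !cons_rowS; exact: xy.
- rewrite integral_rV_cons//; apply: integral0_eq => y _.
  have mB : measurable ((fun s : measurableTypeR R => cons_row s y) @^-1` A).
    by rewrite -[X in measurable X]setTI; exact: measurable_cons_row_left.
  have := integral_indic (@lebesgue_measure R) measurableT mB; rewrite setIT => ->.
  have [[s As]|noA] := pselect (exists s, A (cons_row s y)); last first.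
    rewrite (_ : _ @^-1` _ = set0) ?measure0// -subset0 => s As.
    by apply: noA; exists s.
  apply/eqP; rewrite -measure_le0 -(lebesgue_measure_set1 s); apply: le_measure.
  + by rewrite inE.
  + by rewrite inE.
  + move=> t /= At; have := line _ _ At As; rewrite j0 !cons_row0; apply => i.
    by case: (unliftP ord0 i) => [l ->|->]; rewrite ?eqxx// !cons_rowS.
Qed.

Lemma lebesgue_rV_bounded (R : realType) n (M : R) :
  (lebesgue_rV n [set y : 'rV[R]_n | forall i, (`|y ord0 i| <= M)%R] < +oo)%E.
Proof.
have := @lebesgue_rV_box R n (fun=> `[- M, M]%classic) (fun=> measurable_itv _).
rewrite (_ : [set x | _] = [set y : 'rV[R]_n | forall i, (`|y ord0 i| <= M)%R]).
  move=> ->; rewrite ltey_eq prode_fin_num// => i _.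
  by rewrite lebesgue_measure_itv/=; case: ifP.
apply/seteqP; split => x H i; have := H i; by rewrite /= in_itv/= ler_norml.
Qed.

Lemma measurable_bounded_rV (R : realType) n (M : R) :
  measurable [set y : 'rV[R]_n | forall i, (`|y ord0 i| <= M)%R].
Proof.
apply: closed_measurable_rV.
rewrite (_ : [set y | _] = \bigcap_(i in [set: 'I_n])
   ((fun y : 'rV[R]_n => y ord0 i) @^-1` [set z | `|z| <= M])).
  apply: closed_bigI => i _; apply: closed_comp.
    by move=> x _; exact: coord_continuous.
  rewrite (_ : [set z | _] = Num.norm @^-1` [set z : R | z <= M])//.
  by apply: closed_comp; [move=> z _; exact: norm_continuous|exact: closed_le].
by apply/seteqP; split => y /= H i; [move=> _; exact: H|exact: (H i I)].
Qed.

(** * Compactness, projections and measurability *)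

Lemma behead_row_le (R : realType) n (x y : 'rV[R]_n.+1) :
  `|behead_row x - behead_row y| <= `|x - y|.
Proof.
apply: rV_norm_le => // i; rewrite !mxE.
by have := rV_coord_le (x - y) (lift ord0 i); rewrite !mxE.
Qed.

Lemma continuous_behead_row (R : realType) n :
  continuous (behead_row : 'rV[R]_n.+1 -> 'rV[R]_n).
Proof.
move=> p; apply/(@cvgrPdist_lt _ _ _ (nbhs p)) => e e0.
apply/rV_nearP; exists e => // x xp; rewrite distrC.
exact: le_lt_trans (behead_row_le _ _) xp.
Qed.

Lemma compact_behead_row (R : realType) n (K : set 'rV[R]_n.+1) :
  compact K -> compact (behead_row @` K).
Proof.
by apply: continuous_compact; apply: continuous_subspaceT; exact: continuous_behead_row.
Qed.

(** As [h] is continuous only relative to [K], a cluster point is first placed in the closed set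
    [K], and only then is its value compared with [C]. *)
Lemma compact_preimage (R : realType) n (K : set 'rV[R]_n) (h : 'rV[R]_n -> R)
    (C : set R) :
  compact K -> {within K, continuous h} -> closed C -> compact (K `&` h @^-1` C).
Proof.
move=> cK /rV_within_continuousP hK cC.
apply: (subclosed_compact _ cK); last by move=> x [].
move=> p clp.
have Kp : K p by apply: (compact_closed_rV cK) => U /clp [x [[? _] ?]]; exists x.
split => //; apply: contrapT => nCp.
have /nbhs_normP[e /= e0 eC] : \forall z \near h p, ~ C z.
  by apply: open_nbhs_nbhs; split => //; exact: closed_openC.
have [d d0 dh] := hK p Kp e e0.
have /clp [x [[Kx Cx] xd]] : nbhs p [set x | `|x - p| < d] by apply/rV_nearP; exists d.
by apply: (eC (h x)) => //=; rewrite /ball_/= distrC; exact: dh.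
Qed.

Lemma measurable_fun_superlevel d (T : measurableType d) (R : realType)
    (D : set T) (h : T -> R) :
  measurable D -> (forall c, measurable (D `&` [set x | c <= h x])) ->
  measurable_fun D h.
Proof.
move=> mD mh; apply: (measurability (@RGenCInfty.G R)) => [|/= _ [_] [r] -> <-].
  exact: RGenCInfty.measurableE.
by rewrite set_itvE; exact: mh.
Qed.

Lemma compact_measurable_fun (R : realType) n (K : set 'rV[R]_n) (h : 'rV[R]_n -> R) :
  compact K -> {within K, continuous h} -> measurable_fun K h.
Proof.
move=> cK hK; apply: measurable_fun_superlevel => [|c].
  exact: compact_measurable_rV.
apply: compact_measurable_rV.
by apply: (compact_preimage (C := [set z | c <= z]) cK hK); exact: closed_ge.
Qed.

(** A superlevel set of [G] is the projection of a compact superlevel set of [h], hence compact.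
    This gives measurability of the integrand of the constant, with no regularity asked of the
    inverse of [rho]. *)
Lemma measurable_fun_behead_row (R : realType) n (Z : set 'rV[R]_n.+1)
    (h : 'rV[R]_n.+1 -> R) (G : 'rV[R]_n -> R) :
  compact Z -> {within Z, continuous h} ->
  (forall x, Z x -> G (behead_row x) = h x) ->
  measurable_fun (behead_row @` Z) G.
Proof.
move=> cZ hZ Gh; apply: measurable_fun_superlevel => [|c].
  by apply: compact_measurable_rV; exact: compact_behead_row.
rewrite (_ : _ `&` _ = behead_row @` (Z `&` h @^-1` [set z | c <= z])).
  apply: compact_measurable_rV; apply: compact_behead_row; 
  by apply: (compact_preimage (C := [set z | c <= z]) cZ hZ); exact: closed_ge.
apply/seteqP; split => y.
  by move=> [[x Zx <-]]; rewrite /= Gh// => cx; exists x.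
move=> [x [Zx /= cx] <-]; split; first by exists x.
by rewrite /= Gh.
Qed.

(** * Transversality and null projections *)

(** The two zeros differ only in the coordinates [0] and [lift ord0 i]. These differences solve, up
    to [e] times their size, a homogeneous linear system of nonzero determinant, so they vanish.
    With coordinate [0] projected away, a line in direction [i] thus meets the image of the common
    zeros near [p] at most once. *)
Lemma common_zero_line (R : realType) n (f g : 'rV[R]_n.+1 -> R) p
    (a b : 'I_n.+1 -> R) (i : 'I_n) :
  strict_gradient f p a -> strict_gradient g p b ->
  a ord0 * b (lift ord0 i) != a (lift ord0 i) * b ord0 ->
  exists2 d, 0 < d & forall x y, `|x - p| < d -> `|y - p| < d ->
    f x = 0 -> f y = 0 -> g x = 0 -> g y = 0 ->
    (forall k, k != i -> x ord0 (lift ord0 k) = y ord0 (lift ord0 k)) ->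
    x ord0 (lift ord0 i) = y ord0 (lift ord0 i).
Proof.
move=> fa gb; set j := lift ord0 i => ab.
pose D := a ord0 * b j - a j * b ord0.
have D0 : 0 < `|D| by rewrite normr_gt0 subr_eq0.
pose M := `|a ord0| + `|a j| + `|b ord0| + `|b j|.
have M0 : 0 <= M by rewrite /M !addr_ge0.
(* The two Cramer bounds below add up to [|D| * s <= M * e * s]; with [M * e < |D|] this rules out
   [s > 0]. *)
pose e := `|D| / (M + 1).
have e0 : 0 < e by rewrite divr_gt0// ltr_wpDl.
have Me : M * e < `|D|.
  rewrite /e mulrCA gtr_pMr// ltr_pdivrMr ?mul1r ?ltrDl//; lra.
have [d1 d10 fd] := fa e e0; have [d2 d20 gd] := gb e e0.
exists (Num.min d1 d2); first by rewrite lt_min d10.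
move=> x y; rewrite !lt_min => /andP[x1 x2] /andP[y1 y2] fx fy gx gy xy.
set al := x ord0 ord0 - y ord0 ord0; set be := x ord0 j - y ord0 j.
have sumE (c : 'I_n.+1 -> R) :
    \sum_(k < n.+1) c k * (x ord0 k - y ord0 k) = c ord0 * al + c j * be.
  rewrite big_ord_recl (bigD1 i)//= big1 ?addr0// => k ki.
  by rewrite xy// subrr mulr0.
have nxy : `|x - y| <= `|al| + `|be|.
  apply: rV_norm_le => [|k]; first by rewrite addr_ge0.
  rewrite !mxE; case: (unliftP ord0 k) => [k' ->|->]; last by rewrite lerDl.
  have [->|ki] := eqVneq k' i; first by rewrite lerDr.
  by rewrite xy// subrr normr0 addr_ge0.
have {}fd : `|a ord0 * al + a j * be| <= e * (`|al| + `|be|).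
  have := fd x y x1 y1; rewrite fx fy sumE subrr sub0r normrN => /le_trans; apply.
  by rewrite ler_wpM2l// ltW.
have {}gd : `|b ord0 * al + b j * be| <= e * (`|al| + `|be|).
  have := gd x y x2 y2; rewrite gx gy sumE subrr sub0r normrN => /le_trans; apply.
  by rewrite ler_wpM2l// ltW.
set s := `|al| + `|be| in fd gd.
set F := a ord0 * al + a j * be in fd; set G := b ord0 * al + b j * be in gd.
(* Cramer's rule: [D] is the minor of the two gradients in the coordinates [0], [j]. *)
have Dal : `|D| * `|al| <= (`|b j| + `|a j|) * (e * s).
  rewrite -normrM (_ : D * al = b j * F - a j * G); last by rewrite /D /F /G; ring.
  apply: le_trans (ler_normB _ _) _.
  by rewrite !normrM mulrDl lerD// ler_wpM2l.
have Dbe : `|D| * `|be| <= (`|a ord0| + `|b ord0|) * (e * s).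
  rewrite -normrM (_ : D * be = a ord0 * G - b ord0 * F); last by rewrite /D /F /G; ring.
  apply: le_trans (ler_normB _ _) _.
  by rewrite !normrM mulrDl lerD// ler_wpM2l.
have : `|D| * s <= M * e * s.
  rewrite {1}/s mulrDr; apply: le_trans (lerD Dal Dbe) _.
  by rewrite /M le_eqVlt; apply/orP; left; apply/eqP; ring.
have [s0|s0 Ds] := leP s 0.
  move=> _; apply/eqP; rewrite -subr_eq0 -normr_eq0 -/be.
  have : 0 <= `|al| by []. have : 0 <= `|be| by [].
  by rewrite /s in s0; move=> ? ?; apply/eqP; lra.
by move: Ds; rewrite ler_pM2r// leNgt Me.
Qed.

(** If all these minors vanished, the gradient of [g] would be a multiple of that of [f], since
    [partial f ord0 p] is nonzero. The tangent space of [f] would then lie in that of [g], which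
    would be the whole space, so the gradient of [g] would vanish. *)
Lemma transversal_gradients (R : realType) n (f g : 'rV[R]_n.+1 -> R) p :
  partial f ord0 p <> 0 -> ~ singular_at g p ->
  (forall v, exists u w,
    [/\ tangent_space f p u, tangent_space g p w & v = u + w]) ->
  exists i : 'I_n, partial f ord0 p * partial g (lift ord0 i) p !=
    partial f (lift ord0 i) p * partial g ord0 p.
Proof.
move=> f0 gp tr; apply: contrapT => /forallNP H.
have col k : partial f ord0 p * partial g k p = partial f k p * partial g ord0 p.
  case: (unliftP ord0 k) => [i ->|->]; last by rewrite mulrC.
  by apply/eqP/negPn/negP; exact: H.
have sub u : tangent_space f p u -> tangent_space g p u.
  rewrite /tangent_space/= => fu.
  apply/eqP; rewrite -(mulrI_eq0 _ (lregP (introN eqP f0))).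
  rewrite mulr_sumr (eq_bigr (fun k => partial g ord0 p * (partial f k p * u ord0 k))).
    by rewrite -mulr_sumr fu mulr0.
  by move=> k _; rewrite [LHS]mulrA col; ring.
apply: gp => i.
have [u [w [/sub gu gw uw]]] := tr (delta_mx ord0 i).
have : \sum_k partial g k p * (delta_mx ord0 i : 'rV[R]_n.+1) ord0 k = 0.
  move: gu gw; rewrite /tangent_space /= => gu gw.
  rewrite uw; under eq_bigr do rewrite mxE mulrDr.
  by rewrite big_split/= gu gw addr0.
rewrite (bigD1 i)//= big1 ?addr0; first by rewrite mxE !eqxx mulr1.
by move=> k ki; rewrite mxE (negbTE ki) andbF mulr0.
Qed.

Lemma compact_null_image (R : realType) n (K : set 'rV[R]_n.+1) :
  compact K ->
  (forall p, K p -> exists2 d, 0 < d &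
    lebesgue_rV n (behead_row @` (K `&` [set x | (`|x - p| <= d)%R])) = 0%E) ->
  exists N, [/\ measurable N, lebesgue_rV n N = 0%E & behead_row @` K `<=` N].
Proof.
move=> cK loc.
(* Near-covering along the filter of supersets of null sets, which replaces a
   finite union of local null sets. *)
pose null (N : set 'rV[R]_n) := measurable N /\ lebesgue_rV n N = 0%E.
pose F := filter_from null (fun N => [set N' | N `<=` N']).
have FF : Filter F.
  apply: filter_from_filter; first by exists set0; split; rewrite ?measure0.
  move=> N N' [mN N0] [mN' N'0]; exists (N `|` N').
    split; first exact: measurableU.
    by rewrite measureU0.
  by move=> N'' /= NN; split => y Ny; apply: NN; [left|right].
have := (compact_near_coveringP K).1 cK _ F (fun N x => K x -> N (behead_row x)) FF.
case => [p Kp|N [mN N0] KN]; last first.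
  exists N; split => // y [x Kx <-]; exact: (KN N (fun y h => h) x).
have [d d0 nd] := loc p Kp.
pose ball := [set x : 'rV[R]_n.+1 | `|x - p| <= d].
exists ([set x | `|x - p| < d], [set N | behead_row @` (K `&` ball) `<=` N]).
  split => /=; first by apply/rV_nearP; exists d.
  exists (behead_row @` (K `&` ball)) => //; split => //.
  apply: compact_measurable_rV; apply: compact_behead_row.
  apply: compact_closedI => //.
  rewrite (_ : ball = closed_ball_ Num.norm p d); first exact: closed_closed_ball_.
  by apply/seteqP; split => x; rewrite /ball /closed_ball_/= distrC.
move=> [x N] /= [xd HN] Kx; apply: HN; exists x => //; split => //.
exact: ltW.
Qed.

(** Near an intersection point [S] is [{g = 0}], and transversality supplies a nonzero minor of the
    two gradients. The nearby intersection then projects to a set met at most once by each line in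
    some coordinate direction, hence null; compactness assembles the local null sets. *)
Lemma transversal_null (R : realType) n (Omega S : set 'rV[R]_n.+1) f :
  compact (S `&` Omega `&` [set x | f x = 0]) ->
  analytic_on Omega f -> (forall x, Omega x -> partial f ord0 x <> 0) ->
  intersects_transversally S Omega f ->
  exists N, [/\ measurable N, lebesgue_rV n N = 0%E &
    behead_row @` (S `&` Omega `&` [set x | f x = 0]) `<=` N].
Proof.
set K := _ `&` _ => cK fan f0 tr; apply: compact_null_image => // p [[Sp Op] /= fp].
have [_ [g [gan /rV_nearP[d' d'0 gS] gp] tang]] := tr p Sp Op fp.
have [i ni] := transversal_gradients (f0 _ Op) gp tang.
have [d d0 line] :=
  common_zero_line (analytic_strict (fan _ Op)) (analytic_strict gan) ni.
(* Half the minimum, so that the closed ball of radius [r] fits into both open balls. *)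
pose r := Num.min d d' / 2.
have m0 : 0 < Num.min d d' by rewrite lt_min d0.
have r0 : 0 < r by rewrite divr_gt0.
have rd : r < d.
  have : Num.min d d' <= d by rewrite ge_min lexx.
  by rewrite /r; lra.
have rd' : r < d'.
  have : Num.min d d' <= d' by rewrite ge_min lexx orbT.
  by rewrite /r; lra.
exists r => //; apply: (null_of_lines (j := i)).
  apply: compact_measurable_rV; apply: compact_behead_row.
  apply: compact_closedI => //.
  rewrite (_ : [set x | _] = closed_ball_ Num.norm p r); first exact: closed_closed_ball_.
  by apply/seteqP; split => x; rewrite /closed_ball_/= distrC.
move=> _ _ [x [[[Sx Ox] /= fx] xr] <-] [y [[[Sy Oy] /= fy] yr] <-] xy.
rewrite /behead_row !mxE; apply: line => //.
- exact: le_lt_trans xr rd.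
- exact: le_lt_trans yr rd.
- by apply/gS => //; exact: le_lt_trans xr rd'.
- by apply/gS => //; exact: le_lt_trans yr rd'.
- by move=> k ki; have := xy k ki; rewrite /behead_row !mxE.
Qed.

(** * Slices of the tube *)

(** Compactness of the square of [Omega] reduces the claim to pairs near a given [(p, q)]. On the
    diagonal, the slope is close to [partial f ord0 p]. For distinct points of one vertical line,
    injectivity of [rho] separates [f p] from [f q]. Near points of different vertical lines, no
    pair satisfies the premise. *)
Lemma vertical_separation (R : realType) n (Omega : set 'rV[R]_n.+1) f :
  compact Omega -> analytic_on Omega f ->
  (forall x, Omega x -> partial f ord0 x <> 0) ->
  {in Omega &, injective (rho f)} ->
  exists2 c, 0 < c & forall x y, Omega x -> Omega y -> behead_row x = behead_row y ->
    c * `|x ord0 ord0 - y ord0 ord0| <= `|f x - f y|.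
Proof.
move=> cO fan f0 inj.
pose P c (xy : 'rV[R]_n.+1 * 'rV[R]_n.+1) := behead_row xy.1 = behead_row xy.2 ->
    c * `|xy.1 ord0 ord0 - xy.2 ord0 ord0| <= `|f xy.1 - f xy.2|.
suff /((compact_near_coveringP _).1 (compact_setX cO cO) _ _ P _) sep :
    forall pq, (Omega `*` Omega) pq -> \forall xy \near pq & c \near 0^'+, P c xy.
  near (0 : R)^'+ => c.
  exists c => [|x y Ox Oy]; first by near: c; exact: nbhs_right_gt.
  have : Omega `*` Omega `<=` P c by near: c.
  by move=> /(_ (x, y)); apply.
suff loc p q : Omega p -> Omega q -> exists d c0, [/\ 0 < d, 0 < c0 &
    forall x y c, `|x - p| < d -> `|y - q| < d -> c < c0 -> P c (x, y)].
  move=> [p q] [/= Op Oq]; have [d [c0 [d0 c00 H]]] := loc p q Op Oq.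
  exists ([set xy | `|xy.1 - p| < d /\ `|xy.2 - q| < d], [set c | c < c0]).
    split => /=; last exact: nbhs_right_lt.
    exists ([set x | `|x - p| < d], [set x | `|x - q| < d]) => //.
    by split; apply/rV_nearP; exists d.
  by move=> [[x y] c] /= [[xp yq] cc]; exact: H.
move=> Op Oq.
have [bpq|bpq] := eqVneq (behead_row p) (behead_row q); last first.
  (* Within this radius the two points stay on different vertical lines, so the premise of [P] fails
     and the bound [1] on [c] is arbitrary. *)
  exists (`|behead_row p - behead_row q| / 2), 1; split => //.
    by rewrite divr_gt0// normr_gt0 subr_eq0.
  move=> x y c xp yq _ /= bxy.
  have : `|behead_row p - behead_row q| <= `|x - p| + `|y - q|.
    rewrite (_ : behead_row p - behead_row q =
      (behead_row y - behead_row q) - (behead_row x - behead_row p)).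
      by rewrite [leRHS]addrC (le_trans (ler_normB _ _))// lerD// behead_row_le.
    by rewrite bxy opprB [RHS]addrC addrA subrK.
  by lra.
have [pq|pq] := eqVneq p q.
  subst q; pose a := `|partial f ord0 p|.
  have a0 : 0 < a by rewrite normr_gt0; exact/eqP/f0.
  have a2 : 0 < a / 2 by rewrite divr_gt0.
  have [d d0 fd] := analytic_strict (fan p Op) a2.
  exists d, (a / 2); split => // x y c xp yp ca /= bxy.
  have xyl i : x ord0 (lift ord0 i) = y ord0 (lift ord0 i).
    by have /rowP/(_ i) := bxy; rewrite !mxE.
  have nxy : `|x - y| <= `|x ord0 ord0 - y ord0 ord0|.
    apply: rV_norm_le => // k; rewrite !mxE.
    by case: (unliftP ord0 k) => [i ->|-> //]; rewrite xyl subrr normr0.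
  have := fd x y xp yp; rewrite big_ord_recl big1 ?addr0; last first.
    by move=> i _; rewrite xyl subrr mulr0.
  set u := x ord0 ord0 - y ord0 ord0 in nxy *.
  set w := f x - f y => H.
  have : `|partial f ord0 p * u| <= `|w| + `|w - partial f ord0 p * u|.
    by rewrite -{1}(subKr w (partial f ord0 p * u)) ler_normB.
  rewrite normrM -/a => H'.
  have : `|w - partial f ord0 p * u| <= a / 2 * `|u|.
    by apply: le_trans H _; rewrite ler_wpM2l// ltW.
  have u0 : 0 <= `|u| by [].
  by nra.
have fpq : f p != f q.
  apply: contra_neq pq => fpq; apply: inj; rewrite ?inE//.
  by rewrite /rho fpq bpq.
(* Moving [p] to [x] and [q] to [y] costs less than [e] each, which leaves a gap of at least [e]
   between [f x] and [f y]. *)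
pose e := `|f p - f q| / 3.
have e0 : 0 < e by apply: divr_gt0 => //; rewrite normr_gt0 subr_eq0.
have [d1 d10 fd1] := (rV_continuousP _ _).1
  (strict_gradient_continuous (analytic_strict (fan p Op))) e e0.
have [d2 d20 fd2] := (rV_continuousP _ _).1
  (strict_gradient_continuous (analytic_strict (fan q Oq))) e e0.
pose d := Num.min d1 d2; have d0 : 0 < d by rewrite lt_min d10.
pose M := `|p - q| + d + d.
have M0 : 0 < M by rewrite /M ltr_wpDl// addr_ge0// ltW.
exists d, (e / M); split => //; first exact: divr_gt0.
move=> x y c.
rewrite !lt_min => /[dup] xp' /andP[xp _] /[dup] yq' /andP[_ yq] ce /= _.
have xyM : `|x ord0 ord0 - y ord0 ord0| <= M.
  have := rV_coord_le (x - y) ord0; rewrite !mxE => /le_trans; apply.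
  have -> : x - y = (p - q) + (x - p) - (y - q).
    by apply/rowP => i; rewrite !mxE; ring.
  apply: le_trans (ler_normB _ _) _; apply: lerD; last by rewrite ltW// lt_min.
  apply: le_trans (ler_normD _ _) _; apply: lerD => //.
  by rewrite ltW// lt_min.
have fxy : e <= `|f x - f y|.
  have : `|f p - f q| <= `|f x - f p| + `|f y - f q| + `|f x - f y|.
    have -> : f p - f q = - (f x - f p) + (f y - f q) + (f x - f y) by ring.
    apply: le_trans (ler_normD _ _) _; rewrite lerD2r.
    by apply: le_trans (ler_normD _ _) _; rewrite normrN.
  have := fd1 x xp; have := fd2 y yq; rewrite /e; lra.
(* Only [c < e / M] is known, so [c] may be nonpositive. *)
apply: le_trans fxy; have [c0|c0] := leP c 0.
  by rewrite (le_trans _ (ltW e0))// mulr_le0_ge0.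
apply: (@le_trans _ _ (c * M)); first by rewrite ler_wpM2l// ltW.
by rewrite -ler_pdivlMr// ltW.
Unshelve. all: by end_near.
Qed.

(** A covering argument rather than a minimum of [|f|], so that an empty [C] is no separate case. *)
Lemma compact_away_zero (R : realType) n (C : set 'rV[R]_n) (f : 'rV[R]_n -> R) :
  compact C -> {within C, continuous f} -> (forall x, C x -> f x != 0) ->
  exists2 m, 0 < m & forall x, C x -> m < `|f x|.
Proof.
move=> cC /rV_within_continuousP fC f0.
pose P m x := C x -> m < `|f x|.
suff /((compact_near_coveringP _).1 cC _ _ P _) H :
    forall p, C p -> \forall x \near p & m \near (0 : R)^'+, P m x.
  near (0 : R)^'+ => m.
  exists m => [|x Cx]; first by near: m; exact: nbhs_right_gt.
  have : C `<=` P m by near: m.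
  by move=> /(_ x); apply.
move=> p Cp; have e0 : 0 < `|f p| / 2 by rewrite divr_gt0// normr_gt0 f0.
have [d d0 fd] := fC p Cp _ e0.
exists ([set x | `|x - p| < d], [set m | m < `|f p| / 2]).
  split => /=; last exact: nbhs_right_lt.
  by apply/rV_nearP; exists d.
move=> [x m] /= [xp mp] Cx; have := fd x Cx xp.
have : `|f p| <= `|f x - f p| + `|f x|.
  by rewrite -{1}(subKr (f x) (f p)) [leRHS]addrC ler_normB.
by lra.
Unshelve. all: by end_near.
Qed.

Lemma compact_le_bound (R : realType) n (C : set 'rV[R]_n) (h : 'rV[R]_n -> R) :
  compact C -> {within C, continuous h} ->
  exists2 M, 0 < M & forall x, C x -> h x <= M.
Proof.
move=> cC hC; have /compact_bounded[M [_ HM]] := continuous_compact hC cC.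
exists (`|M| + 1); first by rewrite ltr_wpDl.
move=> x Cx; apply: le_trans (ler_norm _) _.
apply: HM; last by exists x.
by rewrite ltr_pwDr// ler_norm.
Qed.

Lemma integral_le_itv (R : realType) (F : R -> \bar R) (M a b : R) :
  measurable_fun setT F -> (forall s, 0 <= F s)%E -> 0 <= M -> a <= b ->
  (forall s, (F s <= M%:E)%E) ->
  (forall s, F s != 0%E -> a <= s <= b) ->
  (\int[lebesgue_measure]_s F s <= (M * (b - a))%:E)%E.
Proof.
move=> mF F0 M0 ab FM Fab.
apply: (@le_trans _ _ (\int[lebesgue_measure]_(s in `[a, b]) (cst M%:E) s)%E).
  rewrite [leRHS]integral_mkcond; apply: ge0_le_integral => //.
  - apply: (measurable_restrictT (cst M%:E) (measurable_itv `[a, b])).1.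
    exact: measurable_cst.
  - move=> s _; rewrite patchE; case: ifPn => [_|sab]; first exact: FM.
    have [->//|/Fab h] := eqVneq (F s) 0%E.
    by move: sab; rewrite notin_setE/= in_itv/= h.
rewrite integral_cst//= lebesgue_measure_itv/= lte_fin.
by case: ltP => h; rewrite ?mule0 ?lee_fin ?mulr_ge0 ?subr_ge0 ?EFinM ?EFinB.
Qed.

Lemma integral_ge_itv (R : realType) (F : R -> \bar R) (m a b : R) :
  measurable_fun setT F -> (forall s, 0 <= F s)%E -> 0 <= m -> a <= b ->
  (forall s, a <= s <= b -> (m%:E <= F s)%E) ->
  ((m * (b - a))%:E <= \int[lebesgue_measure]_s F s)%E.
Proof.
move=> mF F0 m0 ab Fm.
apply: (@le_trans _ _ (\int[lebesgue_measure]_(s in `[a, b]) (cst m%:E) s)%E).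
  rewrite integral_cst//= lebesgue_measure_itv/= lte_fin.
  case: ltP => h; first by rewrite EFinM EFinB.
  by rewrite mule0 lee_fin (_ : b - a = 0) ?mulr0//; apply/eqP; rewrite subr_eq0 eq_le h.
rewrite [leLHS]integral_mkcond; apply: ge0_le_integral => //.
- by move=> s _; rewrite patchE; case: ifP => // _; rewrite lee_fin.
- apply: (measurable_restrictT (cst m%:E) (measurable_itv `[a, b])).1.
  exact: measurable_cst.
- move=> s _; rewrite patchE; case: ifPn => [|_]; last exact: F0.
  by rewrite inE/= in_itv/=; exact: Fm.
Qed.

Lemma analytic_within_continuous (R : realType) n (A B : set 'rV[R]_n) h :
  B `<=` A -> analytic_on A h -> {within B, continuous h}.
Proof.
move=> BA han; apply/rV_within_continuousP => p /BA Ap e e0.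
have [d d0 hd] := (rV_continuousP _ _).1
  (strict_gradient_continuous (analytic_strict (han p Ap))) e e0.
by exists d => // x _; exact: hd.
Qed.

Lemma cons_row_dist (R : realType) n (s t : R) (y : 'rV[R]_n) :
  `|cons_row s y - cons_row t y| <= `|s - t|.
Proof.
apply: rV_norm_le => // k.
have -> : (cons_row s y - cons_row t y) ord0 k =
    cons_row s y ord0 k - cons_row t y ord0 k by rewrite [LHS]mxE [X in _ + X]mxE.
by case: (unliftP ord0 k) => [i ->|->];
  rewrite ?cons_rowS ?cons_row0 ?subrr ?normr0.
Qed.

Section slices.
Context {R : realType} {n : nat}.
Variables (Omega : set 'rV[R]_n.+1) (f phi : 'rV[R]_n.+1 -> R).
Hypotheses (cO : compact Omega) (fan : analytic_on Omega f).
Hypotheses (phian : analytic_on Omega phi) (phi0 : forall x, Omega x -> 0 < phi x).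
Hypothesis f0 : forall x, Omega x -> partial f ord0 x <> 0.
Hypothesis inj : {in Omega &, injective (rho f)}.

Let E (l : R) := Omega `&` [set x | `|f x| <= l].
Let F (l : R) := (fun x => (phi x)%:E) \_ (E l).

Definition slice_integral (l : R) (y : 'rV[R]_n) : \bar R :=
  (\int[lebesgue_measure]_s F l (cons_row s y))%E.

Let J := slice_integral.

Lemma compact_tube l : compact (E l).
Proof.
apply: (compact_preimage (h := f) (C := [set z | `|z| <= l]) cO).
  exact: (analytic_within_continuous (fun x (Ox : Omega x) => Ox) fan).
rewrite (_ : [set z | _] = Num.norm @^-1` [set z : R | z <= l])//.
by apply: closed_comp; [move=> z _; exact: norm_continuous|exact: closed_le].
Qed.

Let F_in l x : E l x -> F l x = (phi x)%:E.
Proof. by move=> Ex; rewrite /F patchE mem_set. Qed.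

Let F_out l x : ~ E l x -> F l x = 0%E.
Proof. by move=> Ex; rewrite /F patchE memNset. Qed.

Let mF l : measurable_fun setT (F l).
Proof.
apply: (measurable_restrictT _ (compact_measurable_rV (@compact_tube l))).1.
apply/measurable_EFinP; apply: compact_measurable_fun (@compact_tube l) _.
by apply: analytic_within_continuous phian => x [].
Qed.

Let F0 l x : (0 <= F l x)%E.
Proof.
have [Ex|Ex] := pselect (E l x); last by rewrite F_out.
by rewrite F_in// lee_fin ltW// phi0//; case: Ex.
Qed.

Let mFy l y : measurable_fun setT (fun s : R => F l (cons_row s y)).
Proof.
rewrite -[g in measurable_fun _ g]/(F l \o
  (fun s : measurableTypeR R => cons_row s y)).
apply: measurableT_comp; [exact: mF|exact: measurable_cons_row_left].
Qed.

Lemma measurable_slice_integral l : measurable_fun setT (J l).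
Proof. exact: measurable_integral_cons. Qed.

Lemma slice_integral_ge0 l y : (0 <= J l y)%E.
Proof. by apply: integral_ge0 => s _; exact: F0. Qed.

Lemma tube_integralE l :
  tube_integral Omega f phi l = fine (\int[lebesgue_rV n]_y J l y)%E.
Proof.
rewrite /tube_integral /Rintegral; congr fine.
rewrite integral_mkcond -/(E l) -/(F l).
exact: (integral_rV_cons (mF l) (F0 l)).
Qed.

Lemma slice_integral_out l y :
  (forall s, ~ E l (cons_row s y)) -> J l y = 0%E.
Proof.
by move=> H; rewrite /J /slice_integral; apply: integral0_eq => s _; exact: F_out.
Qed.

(** If the slice contains [t], each of its points [s] satisfies [c * |s - t| <= 2 * l] by vertical
    separation, so it lies in an interval of length [4 * l / c], where [phi] is at most [M]. After
    division by [2 * l] this gives the dominating constant. *)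
Lemma slice_integral_le : exists2 K, 0 < K &
  forall l y, 0 < l -> (J l y <= (2 * l * K)%:E)%E.
Proof.
have [M M0 phiM] :=
  compact_le_bound cO
    (analytic_within_continuous (fun x (Ox : Omega x) => Ox) phian).
have [c c0 sep] := vertical_separation cO fan f0 inj.
exists (M * (2 / c)); first by rewrite mulr_gt0// divr_gt0.
move=> l y l0.
have [[t [Ot /= ft]]|noE] := pselect (exists t, E l (cons_row t y)); last first.
  rewrite slice_integral_out; last by move=> s Es; apply: noE; exists s.
  by rewrite lee_fin !mulr_ge0 ?invr_ge0// ltW.
have r0 : 0 <= 2 * l / c by rewrite !mulr_ge0 ?invr_ge0// ltW.
have -> : 2 * l * (M * (2 / c)) = M * (t + 2 * l / c - (t - 2 * l / c)).
  by field; rewrite gt_eqF.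
apply: integral_le_itv => //.
- exact: ltW.
- lra.
- move=> s; have [Es|Es] := pselect (E l (cons_row s y)).
    by rewrite F_in// lee_fin phiM//; case: Es.
  by rewrite F_out// lee_fin ltW.
- move=> s; have [[Os /= fs] _|Es] := pselect (E l (cons_row s y)); last first.
    by rewrite F_out ?eqxx.
  have := sep _ _ Os Ot; rewrite !behead_rowK !cons_row0 => /(_ erefl).
  rewrite mulrC -ler_pdivlMr// => st.
  have : `|f (cons_row s y) - f (cons_row t y)| / c <= 2 * l / c.
    by rewrite ler_pM2r ?invr_gt0// (le_trans (ler_normB _ _))//; lra.
  by move=> /(le_trans st); rewrite ler_norml => /andP[? ?]; apply/andP; split; lra.
Qed.

(** Over points outside one fixed cube, independent of [l], the slices are empty; this confines the
    dominating constant to a set of finite measure. *)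
Lemma slice_integral_support : exists B : R,
  forall l (y : 'rV[R]_n), ~ (forall i, `|y ord0 i| <= B) -> J l y = 0%E.
Proof.
have /compact_bounded[B [_ HB]] := cO.
exists (`|B| + 1) => l y yB; apply: slice_integral_out => s [Os _].
apply: yB => i; have := HB (`|B| + 1) _ _ Os.
rewrite ltr_pwDr// ?ler_norm// => /(_ isT); apply: le_trans.
by have := rV_coord_le (cons_row s y) (lift ord0 i); rewrite cons_rowS.
Qed.

(** The points of [Omega] over [y] with first coordinate outside [O] form a compact set without
    zeros of [f], so [|f|] exceeds some positive [m] there. *)
Lemma tube_slice_localized y (O : set R) : open O ->
  (forall s, Omega (cons_row s y) -> f (cons_row s y) = 0 -> O s) ->
  exists2 m, 0 < m & forall l s, l < m -> E l (cons_row s y) -> O s.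
Proof.
move=> oO HO.
pose C := Omega `&` (behead_row @^-1` [set y] `&`
  (fun x : 'rV[R]_n.+1 => x ord0 ord0) @^-1` (~` O)).
have cC : compact C.
  apply: compact_closedI => //; apply: closedI; apply: closed_comp.
  - by move=> x _; exact: continuous_behead_row.
  - by apply: compact_closed_rV; exact: compact_set1.
  - by move=> x _; exact: coord_continuous.
  - exact: open_closedC.
have CO : C `<=` Omega by move=> x [].
have Cf x : C x -> f x != 0.
  move=> [Ox [/= xy xO]]; apply/eqP => fx; apply: xO.
  by apply: HO; rewrite -xy cons_rowK.
have [m m0 Cm] := compact_away_zero cC (analytic_within_continuous CO fan) Cf.
exists m => // l s lm [Os /= fs]; apply: contrapT => nO.
have := Cm (cons_row s y).
have Cs : C (cons_row s y) by split => //; split; rewrite /= ?behead_rowK ?cons_row0.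
by move=> /(_ Cs); lra.
Qed.

(** With no zero over [y], the localization applies to the empty open set. *)
Lemma slice_integral_away y :
  ~ hypersurface_proj Omega f y ->
  exists2 m, 0 < m & forall l, l < m -> J l y = 0%E.
Proof.
move=> Wy; have zero s : Omega (cons_row s y) -> f (cons_row s y) = 0 -> set0 s.
  by move=> Os fs; apply: Wy; exists (cons_row s y) => //; rewrite behead_rowK.
have [m m0 H] := tube_slice_localized open0 zero.
by exists m => // l lm; apply: slice_integral_out => s; exact: H.
Qed.

(** Along the line, [f] is [partial f ord0 p * (s - s0)] up to [t * |s - s0|]. For small [l] the
    slice thus lies between the intervals of radii [l / (A + t)] and [l / (A - t)] around [s0], and
    [phi] is within [t] of [phi p] on it. *)
Lemma slice_integral_interior s0 y e : 0 < e ->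
  Omega° (cons_row s0 y) -> f (cons_row s0 y) = 0 ->
  let H := phi (cons_row s0 y) / `|partial f ord0 (cons_row s0 y)| in
  exists2 m, 0 < m & forall l, 0 < l -> l < m ->
    ((2 * l * (H - e))%:E <= J l y <= (2 * l * (H + e))%:E)%E.
Proof.
set p := cons_row s0 y => e0 iO fp H.
have Op : Omega p := interior_subset iO.
pose A := `|partial f ord0 p|.
have A0 : 0 < A by rewrite normr_gt0; exact/eqP/f0.
have p0 := phi0 Op.
have H0 : 0 < H by rewrite divr_gt0.
have HA : H * A = phi p by rewrite /H divfK// gt_eqF.
(* The last bound says exactly that [phi p + t <= (H + e) * (A - t)], and it implies
   [(H - e) * (A + t) <= phi p - t]. The other two keep [A - t] and [phi p - t] positive. *)
pose t := Num.min (Num.min (A / 2) (phi p / 2)) (e * A / (1 + H + e)).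
have D0 : 0 < 1 + H + e by rewrite !addr_gt0.
have t0 : 0 < t by rewrite !lt_min !divr_gt0// mulr_gt0.
have tA : t <= A / 2 by rewrite /t !ge_min lexx.
have tp : t <= phi p / 2 by rewrite /t !ge_min lexx orbT.
have te : t * (1 + H + e) <= e * A.
  by rewrite -ler_pdivlMr// /t !ge_min lexx orbT.
clearbody t.
have [d1 d10 fd] := analytic_strict (fan Op) t0.
have [d2 d20 phid] := (rV_continuousP _ _).1
  (strict_gradient_continuous (analytic_strict (phian Op))) t t0.
have /rV_nearP[d3 d30 Od] : \forall x \near p, Omega x by [].
pose d := Num.min d1 (Num.min d2 d3).
have d0 : 0 < d by rewrite !lt_min d10 d20.
have near_p s : `|s - s0| < d -> [/\ Omega (cons_row s y),
    `|f (cons_row s y) - partial f ord0 p * (s - s0)| <= t * `|s - s0| &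
    `|phi (cons_row s y) - phi p| < t].
  rewrite !lt_min => /and3P[s1 s2 s3].
  have sp := cons_row_dist s s0 y; rewrite -/p in sp.
  split.
  - exact: (Od _ (le_lt_trans sp s3)).
  - have := fd (cons_row s y) p (le_lt_trans sp s1).
    rewrite subrr normr0 fp subr0 => /(_ d10).
    rewrite big_ord_recl big1 ?addr0; last first.
      by move=> i _; rewrite /p !cons_rowS subrr mulr0.
    rewrite /p !cons_row0 => /le_trans; apply.
    by rewrite ler_wpM2l// ltW.
  - exact: (phid _ (le_lt_trans sp s2)).
have oball : open [set s | `|s - s0| < d].
  rewrite (_ : [set s | _] = ball s0 d); first exact: ball_open.
  by apply/seteqP; split => s; rewrite /ball/= distrC.
(* By injectivity of [rho], [s0] is the only zero over [y], so for small [l] the whole slice falls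
   into the ball where the estimates hold. *)
have zero s : Omega (cons_row s y) -> f (cons_row s y) = 0 ->
    [set s | `|s - s0| < d] s.
  move=> Os fs; suff -> : s = s0 by rewrite /= subrr normr0.
  have := inj (x := cons_row s y) (y := p); rewrite !inE => /(_ Os Op).
  rewrite /rho fs fp /p !behead_rowK => /(_ erefl).
  move=> /(congr1 (fun x : 'rV[R]_n.+1 => x ord0 ord0)).
  by rewrite !cons_row0.
have [m1 m10 loc] := tube_slice_localized oball zero.
(* The second bound keeps the inner interval, of radius [l / (A + t)], inside that ball. *)
exists (Num.min m1 ((A + t) * d)); first by rewrite lt_min m10 mulr_gt0// addr_gt0.
move=> l l0; rewrite lt_min => /andP[lm ld].
have At0 : 0 < A - t by lra.
have At1 : 0 < A + t by lra.
apply/andP; split.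
- pose r := l / (A + t).
  have r0 : 0 < r by rewrite divr_gt0.
  apply: (@le_trans _ _ ((phi p - t) * ((s0 + r) - (s0 - r)))%:E).
    rewrite lee_fin (_ : s0 + r - (s0 - r) = 2 * r); last by ring.
    rewrite mulrA /r mulrA ler_pdivlMr//.
    have : (H - e) * (A + t) <= phi p - t by nra.
    by move=> h; nra.
  apply: integral_ge_itv => //; [lra|lra|].
  move=> s srs.
  have srs' : `|s - s0| <= r by rewrite ler_norml; lra.
  have sd : `|s - s0| < d.
    by apply: le_lt_trans srs' _; rewrite /r ltr_pdivrMr// mulrC.
  have [Os fs ps] := near_p s sd.
  rewrite F_in.
    by rewrite lee_fin; move: ps; rewrite ltr_norml; lra.
  split => //=.
  have -> : f (cons_row s y) = (f (cons_row s y) - partial f ord0 p * (s - s0)) +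
      partial f ord0 p * (s - s0) by ring.
  apply: le_trans (ler_normD _ _) _; rewrite [in X in _ + X]normrM -/A.
  have : (A + t) * `|s - s0| <= l by rewrite mulrC -ler_pdivlMr.
  by lra.
(* Here the localization puts each point of the slice in the ball, where
   [(A - t) * |s - s0| <= |f|]. *)
- pose r := l / (A - t).
  have r0 : 0 < r by rewrite divr_gt0.
  apply: (@le_trans _ _ ((phi p + t) * ((s0 + r) - (s0 - r)))%:E); last first.
    rewrite lee_fin (_ : s0 + r - (s0 - r) = 2 * r); last by ring.
    rewrite mulrA /r mulrA ler_pdivrMr//.
    have : phi p + t <= (H + e) * (A - t) by nra.
    by move=> h; nra.
  apply: integral_le_itv => //; [lra|lra| |].
  + move=> s; have [Es|Es] := pselect (E l (cons_row s y)); last first.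
      by rewrite F_out// lee_fin; lra.
    have [_ _ ps] := near_p s (loc _ _ lm Es).
    by rewrite F_in// lee_fin; move: ps; rewrite ltr_norml; lra.
  + move=> s; have [Es _|Es] := pselect (E l (cons_row s y)); last first.
      by rewrite F_out ?eqxx.
    have [_ fs _] := near_p s (loc _ _ lm Es).
    have [_ /= fl] := Es.
    have : A * `|s - s0| <= `|f (cons_row s y)| + t * `|s - s0|.
      rewrite -normrM -{1}(subKr (f (cons_row s y)) (_ * _)).
      by apply: le_trans (ler_normB _ _) _; rewrite lerD2l.
    move=> h; have : `|s - s0| <= r by rewrite /r ler_pdivlMr//; lra.
    by rewrite ler_norml => /andP[? ?]; apply/andP; split; lra.
Qed.

End slices.

(** * Rescaled slices and dominated convergence *)

Theorem theorem8p3 (R : realType) (n : nat)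
    (Omega : set 'rV[R]_n.+1) (f phi : 'rV[R]_n.+1 -> R)
    (rhoinv : 'rV[R]_n.+1 -> 'rV[R]_n.+1) :
  compact Omega -> full_dimensional Omega -> semianalytic Omega ->
  analytic_on Omega f ->
  smooth_hypersurface Omega f ->
  (exists x : 'rV[R]_n.+1, Omega° x /\ f x = 0) ->
  analytic_on Omega phi -> (forall x, Omega x -> 0 < phi x) ->
  (forall x, Omega x -> partial f ord0 x <> 0) ->
  (forall x, Omega x -> rhoinv (rho f x) = x) ->
  intersects_transversally (boundary Omega) Omega f ->
  tube_integral Omega f phi =
    (fun lambda => tube_constant Omega f phi rhoinv * lambda)
    +o_ (0^'+) (fun lambda : R => lambda).
Proof.
move=> cO _ _ fan _ _ phian phi0 f0 rhoK tr.
have inj : {in Omega &, injective (rho f)}.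
  by move=> x y; rewrite !inE => Ox Oy fxy; rewrite -(rhoK x)// fxy rhoK.
have clO := compact_closed_rV cO.
pose Z := Omega `&` [set x | f x = 0].
pose H x := phi x / `|partial f ord0 x|.
pose h (y : 'rV[R]_n) := (H \o rhoinv) (cons_row 0 y).
pose W := hypersurface_proj Omega f.
have hH x : Z x -> h (behead_row x) = H x.
  by move=> [Ox /= fx]; rewrite /h /= -[in LHS]fx -/(rho f x) rhoK.
have ZO : Z `<=` Omega by move=> x [].
have cZ : compact Z.
  apply: (compact_preimage (h := f) (C := [set z | z = 0]) cO); last exact: closed_eq.
  exact: analytic_within_continuous fan.
have HZ : {within Z, continuous H}.
  apply/subspace_continuousP => x Zx.
  apply: cvgM.
    exact: ((subspace_continuousP _ _).1 (analytic_within_continuous ZO phian) x Zx).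
  apply: cvgV; first by rewrite normr_eq0; apply/eqP/f0/ZO.
  apply: cvg_norm.
  have fanZ : analytic_on Z f by move=> z /ZO; exact: fan.
  exact: ((subspace_continuousP _ _).1 (partial_continuous (i := ord0) fanZ) x Zx).
have mW : measurable W by apply: compact_measurable_rV; exact: compact_behead_row.
have mh : measurable_fun W h by exact: measurable_fun_behead_row HZ hH.
have [N [mN N0 bN]] : exists N, [/\ measurable N, lebesgue_rV n N = 0%E &
    behead_row @` (boundary Omega `&` Omega `&` [set x | f x = 0]) `<=` N].
  apply: transversal_null => //.
  (* The zeros on the boundary are those of [Z] outside the open interior, hence a compact set. *)
  rewrite (_ : _ `&` _ = Z `&` ~` Omega°).
    by apply: compact_closedI => //; apply: open_closedC; exact: open_interior.
  apply/seteqP; split => x; first by move=> [[[_ nx] Ox] fx].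
  move=> [[Ox fx] nx]; split => //; split => //; split => //.
  exact: subset_closure.
have [K K0 JK] := slice_integral_le cO fan phian phi0 f0 inj.
have [B JB] := slice_integral_support f phi cO.
pose J := slice_integral Omega f phi.
pose Q := [set y : 'rV[R]_n | forall i, `|y ord0 i| <= B].
have mQ : measurable Q by exact: measurable_bounded_rV.
have J0 l y : (0 <= J l y)%E by exact: slice_integral_ge0.
have mJ l : measurable_fun setT (J l) by exact: measurable_slice_integral.
pose V := tube_integral Omega f phi.
pose c := \int[lebesgue_rV n]_(y in W) h y.
suff lim : (2 * l)^-1 * V l @[l --> 0^'+] --> c.
  apply/eqaddoP => e e0.
  have e2 : 0 < e / 2 by rewrite divr_gt0.
  move/cvgrPdist_le : lim => /(_ _ e2) lim.
  near=> l.
  have l0 : 0 < l by near: l; exact: nbhs_right_gt.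
  have : `|c - (2 * l)^-1 * V l| <= e / 2 by near: l.
  rewrite /= (_ : (V - _) l = V l - 2 * c * l)// (gtr0_norm l0) => cl.
  have -> : V l - 2 * c * l = - (2 * l) * (c - (2 * l)^-1 * V l).
    by field; rewrite gt_eqF.
  have l2 : 0 < 2 * l by rewrite mulr_gt0.
  rewrite normrM normrN (gtr0_norm l2).
  apply: (@le_trans _ _ (2 * l * (e / 2))); first by rewrite ler_pM2l.
  by rewrite le_eqVlt; apply/orP; left; apply/eqP; field.
(* The limit is taken along sequences, the form in which dominated convergence applies. *)
apply/cvg_at_rightP => u [u0 ucvg].
pose J_ k y := (((2 * u k)^-1)%:E * J (u k) y)%E.
pose g := (EFin \o h) \_ W.
have c_u k : 0 < (2 * u k)^-1 by rewrite invr_gt0 mulr_gt0.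
have JQ k y : ~ Q y -> J (u k) y = 0%E by exact: JB.
have J_le k y : (J_ k y <= K%:E)%E.
  rewrite /J_ muleC lee_pdivrMr ?mulr_gt0// -EFinM mulrC.
  exact: JK.
have mJ_ k : measurable_fun setT (J_ k) by exact: measurable_funeM.
have mg : measurable_fun setT g.
  by apply: (measurable_restrictT _ mW).1; exact/measurable_EFinP.
(* The exceptional set is [N]. Off it, either [y] is outside [W] and the slices are eventually
   empty, or the zero over [y] is interior to [Omega]. *)
have lim_ae : {ae lebesgue_rV n, forall y, setT y -> J_ ^~ y @ \oo --> g y}.
  exists N; split => // y /= /not_implyP[_ nlim]; apply: contrapT => Ny.
  apply: nlim.
  have near_u m : 0 < m -> \forall k \near \oo, u k < m.
    by move=> m0; exact: (cvgr_lt 0 ucvg m m0).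
  have [Wy|Wy] := pselect (W y); last first.
    rewrite /g patchE memNset//.
    have [m m0 Jm] := slice_integral_away phi cO fan Wy.
    apply: cvg_near_cst; have := near_u m m0; apply: filterS => k km.
    by rewrite /J_ /J Jm// mule0.
  rewrite /g patchE mem_set//.
  have [x [Ox /= fx] xy] := Wy.
  have iOx : Omega° x.
    apply: contrapT => nx; apply: Ny; apply: bN; exists x => //; split => //.
    by split => //; split => //; exact: subset_closure.
  have hx : h y = H x by rewrite -xy hH.
  have xE : cons_row (x ord0 ord0) y = x by rewrite -xy cons_rowK.
  have Jfin k : J_ k y = (fine (J_ k y))%:E.
    rewrite fineK// ge0_fin_numE; last by rewrite mule_ge0// lee_fin ltW.
    by apply: le_lt_trans (J_le k y) _; rewrite ltry.
  rewrite (_ : J_ ^~ y = EFin \o (fun k => fine (J_ k y))); last first.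
    by apply/funext => k /=; exact: Jfin.
  apply: cvg_EFin; first by near=> k.
  apply/cvgrPdist_le => e e0.
  have := slice_integral_interior cO fan phian phi0 f0 inj
    (s0 := x ord0 ord0) (y := y) e0.
  rewrite xE => /(_ iOx fx) /= [m m0 Jm].
  have := near_u m m0; apply: filterS => k km.
  have /andP[lo hi] := Jm (u k) (u0 k) km.
  have lo' : (((H x - e))%:E <= J_ k y)%E.
    rewrite /J_ muleC lee_pdivlMr ?mulr_gt0// -EFinM mulrC; exact: lo.
  have hi' : (J_ k y <= (H x + e)%:E)%E.
    rewrite /J_ muleC lee_pdivrMr ?mulr_gt0// -EFinM mulrC; exact: hi.
  move: lo' hi'; rewrite Jfin !lee_fin hx => lo' hi'.
  by rewrite /= ler_norml; apply/andP; split; lra.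
(* The uniform slice bound [K], restricted to the cube [Q] outside which all slices vanish. *)
pose dom : 'rV[R]_n -> \bar R := (EFin \o cst K) \_ Q.
have domI : (lebesgue_rV n).-integrable setT dom.
  apply/(integrable_mkcond _ mQ)/integrableP; split.
    exact/measurable_EFinP.
  rewrite (eq_integral (cst K%:E)); last by move=> y _ /=; rewrite gtr0_norm.
  rewrite integral_cst//= lte_mul_pinfty ?lee_fin ?(ltW K0)//.
  exact: lebesgue_rV_bounded.
have domJ : {ae lebesgue_rV n, forall y k, setT y -> (`|J_ k y| <= dom y)%E}.
  apply: aeW => y k _; rewrite gee0_abs; last by rewrite mule_ge0// lee_fin ltW.
  rewrite /dom patchE; case: ifPn => [_|]; first exact: J_le.
  by rewrite notin_setE => Qy; rewrite /J_ JQ// mule0.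
have [Ig _ Jcvg] := dominated_convergence measurableT mJ_ mg lim_ae domI domJ.
have gE : (\int[lebesgue_rV n]_y g y = c%:E)%E.
  rewrite -integral_mkcond /c /Rintegral fineK//.
  by apply: integrable_fin_num => //; apply/(integrable_mkcond _ mW).
rewrite [X in _ --> X](_ : c = fine c%:E)// -gE.
(* The factor passes through [fine] for infinite integrals too, since [fine] sends both infinities
   to [0]. *)
have -> : (fun k => (2 * u k)^-1 * V (u k)) =
    (fun k => fine (\int[lebesgue_rV n]_y J_ k y)%E).
  apply/funext => k; rewrite /V tube_integralE// ge0_integralZl//; last first.
    by rewrite lee_fin ltW.
  case: (\int[lebesgue_rV n]_y _)%E => [r||] /=; first by [].
    by rewrite gt0_muley ?lte_fin// mulr0.
  by rewrite gt0_muleNy ?lte_fin// mulr0.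
apply: fine_cvg; rewrite fineK; last by rewrite gE.
exact: Jcvg.
Unshelve. all: by end_near.
Qed.
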